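(* Let $r\ge 2$, let $2\le m_1\le\cdots\le m_r$ be integers, and let $S\subset D_r^{\mathbb{N}}$ be any nonempty sofic system, defined by a finite directed graph $G$ with a right-resolving labelling of its edges by $D_r$. Let $X=R(S)\subset\mathbb{T}^r$ be the corresponding sofic set, let $A_s$ ($s\in D_{r-1}$) be the restricted adjacency matrices of $G$, and let $a_i=\log_{m_{i+1}}m_i$ for $1\le i\le r-1$. Then, for an arbitrary matrix norm $\|\cdot\|$, the following limit exists and $$\dim_{\mathrm H}(X)=\lim_{N\to\infty}\frac1N\log_{m_1}\sum_{s_1\in D_1^N}\left(\sum_{s_2\in D_2^N(s_1)}\left(\cdots\left(\sum_{\substack{s_{r-1}\in D_{r-1}^N(s_{r-2})\\ s_{r-1}=(s^{(1)},\dots,s^{(N)})}}\left\|A_{s^{(1)}}\cdots A_{s^{(N)}}\right\|^{a_{r-1}}\right)^{a_{r-2}}\cdots\right)^{a_2}\right)^{a_1}.$$ (For $r=2$ the expression inside the logarithm is $\sum_{s_1=(s^{(1)},\dots,s^{(N)})\in D_1^N}\|A_{s^{(1)}}\cdots A_{s^{(N)}}\|^{a_1}$.)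
   Context: Let $I_i=\{0,1,\dots,m_i-1\}$ and $D_i=I_1\times\cdots\times I_i$ for $1\le i\le r$. For $2\le i\le r$ and a word $s_{i-1}\in D_{i-1}^N$, $D_i^N(s_{i-1})$ is the set of words $s\in D_i^N$ whose image under forgetting the $i$-th component of each symbol is $s_{i-1}$. The map $R:D_r^{\mathbb{N}}\to\mathbb{T}^r=\mathbb{R}^r/\mathbb{Z}^r$ is $R\left((e^{(n)}_1,\dots,e^{(n)}_r)_{n\ge1}\right)=\left(\sum_{k=1}^\infty e_1^{(k)}m_1^{-k},\dots,\sum_{k=1}^\infty e_r^{(k)}m_r^{-k}\right)$. $\mathbb{T}^r$ carries its standard flat metric and $\dim_{\mathrm H}$ is Hausdorff dimension. Sofic system: let $G=\langle V,E\rangle$ be a finite directed graph, loops and multiple edges allowed, whose edges are labelled by elements of $D_r$ in a right-resolving fashion, i.e. any two distinct edges emanating from the same vertex have different labels. The set $S\subset D_r^{\mathbb{N}}$ of label sequences of infinite paths in $G$ is the sofic system defined by $G$, and $R(S)$ is the associated sofic set. Restricted adjacency matrices: write $V=\{v_1,\dots,v_n\}$. For $s\in D_{r-1}$, $A_s=(a_{ij}(s))_{i,j}$ is the $n\times n$ matrix where $a_{ij}(s)$ is the number of edges from $v_i$ to $v_j$ whose label is $(s,k)\in D_r$ for some $k\in I_r$. The convention $0^a=0$ for $a>0$ is used. *)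

(* Defs.v *)
From HB Require Import structures.
From mathcomp Require Import all_boot all_order all_algebra.
From mathcomp Require Import all_classical all_reals all_analysis.
From mathcomp Require Import ring.

Set Implicit Arguments.
Unset Strict Implicit.
Unset Printing Implicit Defensive.

Import Order.TTheory GRing.Theory Num.Theory.
Import numFieldNormedType.Exports.

Local Open Scope classical_set_scope.
Local Open Scope ring_scope.

Section HausdorffDimension.
Context {R : realType} {T : metricType R}.
Implicit Types (A U : set T) (s delta : R).

(* Equal to -oo on the empty set. *)
Definition diam A : \bar R :=
  ereal_sup [set (mdist x.1 x.2)%:E | x in A `*` A].

(* The empty set contributes 0 for every s, and a nonempty set contributes 1
   for s = 0 (0 `^ 0 = 1). *)
Definition diam_pow s U : \bar R :=
  if U == set0 then 0%E else poweR (diam U) s.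

Definition hausdorff_premeasure s delta A : \bar R :=
  ereal_inf [set (\sum_(0 <= k <oo) diam_pow s (U k))%E | U in
    [set U : nat -> set T |
      A `<=` \bigcup_k U k /\ forall k, (diam (U k) <= delta%:E)%E]].

Definition hausdorff_measure s A : \bar R :=
  ereal_sup [set hausdorff_premeasure s delta A | delta in [set d | 0 < d]].

Definition hausdorff_dim A : \bar R :=
  ereal_inf [set s%:E | s in [set s | 0 <= s /\ hausdorff_measure s A = 0%E]].

End HausdorffDimension.

Section EuclideanNorm.
Context {R : realType} {r : nat}.
Implicit Types x y : 'rV[R]_r.

(* The norm carried by 'rV[R]_r in the library is the sup norm. *)
Definition enorm x : R := Num.sqrt (\sum_j x 0 j ^+ 2).

Lemma sumsq_ge0 x : 0 <= \sum_j x 0 j ^+ 2.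
Proof. by apply: sumr_ge0 => j _; exact: sqr_ge0. Qed.

Lemma enorm_ge0 x : 0 <= enorm x.
Proof. exact: sqrtr_ge0. Qed.

Lemma enorm0 : enorm 0 = 0.
Proof.
rewrite /enorm big1 ?sqrtr0// => j _.
by rewrite mxE expr0n.
Qed.

Lemma enormN x : enorm (- x) = enorm x.
Proof. by congr Num.sqrt; apply: eq_bigr => j _; rewrite mxE sqrrN. Qed.

Lemma ler_coord_enorm x j : `|x 0 j| <= enorm x.
Proof.
rewrite -sqrtr_sqr ler_wsqrtr// (bigD1 j)//= lerDl.
by apply: sumr_ge0 => i _; exact: sqr_ge0.
Qed.

Lemma enorm_eq0 x : enorm x = 0 -> x = 0.
Proof.
move=> x0; apply/rowP => j; rewrite mxE; apply/eqP.
by rewrite -normr_le0 -x0 ler_coord_enorm.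
Qed.

Lemma cauchy_schwarz x y :
  (\sum_j x 0 j * y 0 j) ^+ 2 <= (\sum_j x 0 j ^+ 2) * (\sum_j y 0 j ^+ 2).
Proof.
set a := \sum_j x 0 j ^+ 2; set b := \sum_j _; set c := \sum_j y 0 j ^+ 2.
have [c0|c_neq0] := eqVneq c 0.
  have y0 : y = 0 by apply: enorm_eq0; rewrite /enorm -/c c0 sqrtr0.
  by rewrite /b y0 big1 ?expr0n ?c0 ?mulr0// => j _; rewrite mxE mulr0.
have c_gt0 : 0 < c by rewrite lt_neqAle eq_sym c_neq0 sumsq_ge0.
have : 0 <= \sum_j (c * x 0 j - b * y 0 j) ^+ 2.
  by apply: sumr_ge0 => j _; exact: sqr_ge0.
have -> : \sum_j (c * x 0 j - b * y 0 j) ^+ 2 =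
    \sum_j (c ^+ 2 * x 0 j ^+ 2 - 2 * b * c * (x 0 j * y 0 j)
            + b ^+ 2 * y 0 j ^+ 2).
  by apply: eq_bigr => j _; ring.
rewrite big_split/= sumrB -!mulr_sumr -/a -/b -/c.
have -> : c ^+ 2 * a - 2 * b * c * b + b ^+ 2 * c = c * (a * c - b ^+ 2).
  by ring.
by rewrite pmulr_rge0// subr_ge0.
Qed.

Lemma ler_enormD x y : enorm (x + y) <= enorm x + enorm y.
Proof.
have xy0 : 0 <= enorm x + enorm y by rewrite addr_ge0 ?enorm_ge0.
rewrite -(ler_pXn2r (n := 2))// ?nnegrE ?enorm_ge0//.
rewrite sqrrD !sqr_sqrtr ?sumsq_ge0//.
have -> : \sum_j (x + y) 0 j ^+ 2 =
    \sum_j x 0 j ^+ 2 + (\sum_j x 0 j * y 0 j) *+ 2 + \sum_j y 0 j ^+ 2.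
  rewrite -sumrMnl -!big_split/=; apply: eq_bigr => j _.
  by rewrite mxE sqrrD.
rewrite lerD2r lerD2l lerMn2r/= -sqrtrM ?sumsq_ge0//.
rewrite (le_trans (ler_norm _))// -sqrtr_sqr ler_wsqrtr//.
exact: cauchy_schwarz.
Qed.

End EuclideanNorm.

Section Torus.
Variables (R : realType) (r : nat).

Definition integer_lattice : {pred 'rV[R]_r} := mxOver Num.int.

Fact integer_lattice_zmod : zmod_closed integer_lattice.
Proof.
split=> [|x y /mxOverP xZ /mxOverP yZ]; apply/mxOverP => i j; rewrite !mxE.
  exact: rpred0.
exact: rpredB.
Qed.

HB.instance Definition _ :=
  GRing.isZmodClosed.Build _ integer_lattice integer_lattice_zmod.

Definition torus := Quotient.quot integer_lattice.

HB.instance Definition _ := ZmodQuotient.on torus.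

Definition to_torus (x : 'rV[R]_r) : torus := (\pi_torus x)%qT.

Implicit Types p q : torus.

Lemma to_torusB x y : to_torus (x - y) = to_torus x - to_torus y.
Proof. exact: (raddfB \pi_torus%qT). Qed.

Lemma to_torusD x y : to_torus (x + y) = to_torus x + to_torus y.
Proof. exact: (raddfD \pi_torus%qT). Qed.

Lemma to_torusN x : to_torus (- x) = - to_torus x.
Proof. exact: (raddfN \pi_torus%qT). Qed.

Lemma to_torus0 : to_torus 0 = 0.
Proof. exact: (raddf0 \pi_torus%qT). Qed.

Lemma to_torus_surj p : exists x, to_torus x = p.
Proof. by exists (repr p); rewrite /to_torus reprK. Qed.

Lemma eq_to_torus x y :
  to_torus x = to_torus y <-> forall j, x 0 j - y 0 j \is a Num.int.
Proof.
have -> : (to_torus x = to_torus y) <-> (x - y \in integer_lattice).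
  by rewrite Quotient.idealrBE; split=> [/eqP|/eqP].
split=> [/mxOverP xyZ j|xyZ]; first by have := xyZ 0 j; rewrite !mxE.
by apply/mxOverP => i j; rewrite (ord1 i) !mxE.
Qed.

Definition torus_dist p q : R :=
  inf [set enorm x | x in [set x | to_torus x = p - q]].

Let norms p : set R := [set enorm x | x in [set x | to_torus x = p]].

Let norms_lb p : lbound (norms p) 0.
Proof. by move=> _ [x _ <-]; exact: enorm_ge0. Qed.

Let norms_inf p : has_inf (norms p).
Proof.
split; last by exists 0; exact: norms_lb.
by have [x <-] := to_torus_surj p; exists (enorm x), x.
Qed.

Lemma torus_distxx p : torus_dist p p = 0.
Proof.
apply/eqP; rewrite eq_le; apply/andP; split; last first.
  by apply: lb_le_inf; [exact: (norms_inf _).1|exact: norms_lb].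
apply: ge_inf; first exact: (norms_inf _).2.
by exists 0; rewrite ?enorm0//= subrr to_torus0.
Qed.

Lemma torus_dist_sym p q : torus_dist p q = torus_dist q p.
Proof.
congr inf; apply/seteqP; split=> _ [x /= xpq <-].
  by exists (- x); rewrite ?enormN//= to_torusN xpq opprB.
by exists (- x); rewrite ?enormN//= to_torusN xpq opprB.
Qed.

Lemma torus_dist_triangle q p s :
  torus_dist p s <= torus_dist p q + torus_dist q s.
Proof.
rewrite -inf_sumE; [|exact: norms_inf..].
apply: lb_le_inf.
  have [x xpq] := to_torus_surj (p - q).
  have [y yqs] := to_torus_surj (q - s).
  exists (enorm x + enorm y), (enorm x); first by exists x.
  by exists (enorm y) => //; exists y.
move=> _ [_ [x /= xpq <-]] [_ [y /= yqs <-]] <-.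
apply: le_trans (ler_enormD x y).
apply: ge_inf; first exact: (norms_inf _).2.
by exists (x + y) => //=; rewrite to_torusD xpq yqs addrA subrK.
Qed.

Lemma torus_dist_eq0 p q : torus_dist p q = 0 -> p = q.
Proof.
move=> pq0.
have small e : 0 < e -> exists2 x, to_torus x = p - q & enorm x < e.
  move=> e0; have [_ [x xpq <-]] := inf_adherent e0 (norms_inf (p - q)).
  by rewrite -/(torus_dist p q) pq0 add0r => xe; exists x.
have [x xpq x12] := small (2^-1) ltac:(by rewrite invr_gt0).
have [x0|x_neq0] := eqVneq (enorm x) 0.
  apply/eqP; rewrite -subr_eq0 -xpq (enorm_eq0 x0).
  by rewrite to_torus0.
have [|y ypq yx] := small (enorm x); first by rewrite lt_def x_neq0 enorm_ge0.
suff xy : x = y by rewrite xy ltxx in yx.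
apply/rowP => j; apply/eqP; rewrite -subr_eq0.
have /eq_to_torus/(_ j) xyZ : to_torus x = to_torus y by rewrite xpq ypq.
apply: contraTT isT => xy_neq0.
have := norm_intr_ge1 xyZ xy_neq0.
rewrite leNgt (le_lt_trans (ler_normB _ _))//.
rewrite (le_lt_trans (lerD (ler_coord_enorm _ _) (ler_coord_enorm _ _)))//.
by rewrite [ltRHS]splitr ltrD// ?mul1r// (lt_trans yx).
Qed.

HB.instance Definition _ := @isMetric.Build R torus torus_dist
  torus_distxx torus_dist_eq0 torus_dist_sym torus_dist_triangle.

End Torus.

Section Words.
Variable m : nat -> nat.

(* D i = I_1 x ... x I_i.  The j-th coordinate (counting from 1) of a symbol is
   stored at index j - 1. *)
Definition D (i : nat) := {dffun forall j : 'I_i, 'I_(m j.+1)}.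

Definition word (i N : nat) := N.-tuple (D i).

Definition forget (i : nat) (d : D i) : D i.-1 :=
  [ffun j : 'I_i.-1 => d (widen_ord (leq_pred i) j)].

Definition forget_word (i N : nat) (s : word i N) : word i.-1 N :=
  map_tuple (@forget i) s.

(* sum_(s_1 in D_1^N) (sum_(s_2 in D_2^N(s_1)) (... (sum_(s_i in D_i^N(s_(i-1)))
   F s_i) ^ a_(i-1) ...) ^ a_2) ^ a_1 *)
Fixpoint nested_sum (R : realType) (a : nat -> R) (N i : nat) :
    (word i N -> R) -> R :=
  match i with
  | 0 => fun F => \sum_s F s
  | i'.+1 => fun F =>
      if i' == 0%N then \sum_s F s
      else nested_sum a (fun s : word i' N =>
        (\sum_(s' : word i'.+1 N | forget_word s' == s) F s') `^ a i')
  end.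

Definition expansion (R : realType) (r : nat) (w : nat -> D r) : torus R r :=
  to_torus (\row_j
    limn (series (fun k => (w k j)%:R * (m j.+1)%:R ^- k.+1 : R))).

End Words.

Record labelled_graph (L : finType) := LabelledGraph {
  nvert : nat;
  edge : finType;
  source : edge -> 'I_nvert;
  target : edge -> 'I_nvert;
  label : edge -> L
}.

Definition right_resolving (L : finType) (G : labelled_graph L) : Prop :=
  forall e f : edge G, e != f -> source e = source f -> label e != label f.

Definition sofic (L : finType) (G : labelled_graph L) : set (nat -> L) :=
  [set w | exists p : nat -> edge G,
    (forall k, target (p k) = source (p k.+1)) /\
    forall k, w k = label (p k)].

(* The label of e is (d, k) for some k in I_r iff forgetting its last coordinate
   gives d. *)
Definition restricted_adj (R : realType) (m : nat -> nat) (r : nat)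
    (G : labelled_graph (D m r)) (d : D m r.-1) : 'M[R]_(nvert G) :=
  \matrix_(i, j) #|[set e : edge G |
    [&& source e == i, target e == j & forget (label e) == d]]|%:R.

Definition matrix_norm (R : realType) (n : nat) (f : 'M[R]_n -> R) : Prop :=
  [/\ forall A, f A = 0 -> A = 0,
      forall c A, f (c *: A) = `|c| * f A
    & forall A B, f (A + B) <= f A + f B].

Definition log_base (R : realType) (b x : R) : R := ln x / ln b.

(* Main.v *)
(* For a finite set B of words of length N over D_r, let Z(B) be the nested sum of the
   statement, with the number of words of B above s_(r-1) in place of the norm.

   Let W_N be the set of words of length N that label a path of G; if A is the product of
   the matrices A_(s^(k)), then, up to constants, ||A|| is the number of words of W_N above
   s_(r-1), because the labelling is right-resolving and all norms are equivalent.
   (1) dim X <= log Z(W_N) / (N log m_1): X lies in the self-affine set of all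
   concatenations of words of W_N, and McMullen's Bernoulli weights on approximate cubes
   give the bound. Along every point the logarithm of the weight of the cube at scale n is
   -n log Z(W_N) up to differences of Birkhoff averages taken at proportional times; their
   sum over geometrically growing scales telescopes, so that in each window of boundedly
   many scales some scale has an almost optimal weight.
   (2) For a vertex u and the set B of words of length N labelling loops at u, all
   concatenations of words of B are in the sofic system. Dyadic pigeonholing, one
   coordinate at a time, replaces B by a subset with almost constant branching numbers at
   the cost of a factor polynomial in N, and the uniform weights on that subset give
   Z(B) <= poly(N) m_1^(N dim X) by the mass distribution principle.
   (3) Cutting a path at the last visit to its initial vertex, and iterating, decomposes it
   into boundedly many loops. As Z is multiplicative on concatenations and subadditive on
   unions, (2) gives Z(W_N) <= poly(N) m_1^(N dim X). *)

Require Import Defs.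
From HB Require Import structures.
From mathcomp Require Import all_boot all_order all_algebra.
From mathcomp Require Import all_classical all_reals all_analysis.
From mathcomp Require Import zify ring lra.

Set Implicit Arguments.
Unset Strict Implicit.
Unset Printing Implicit Defensive.

Import Order.TTheory GRing.Theory Num.Theory.
Import numFieldNormedType.Exports.

Local Open Scope classical_set_scope.
Local Open Scope ring_scope.

(** * Nested sums over a filtered finite set *)

Lemma powR_homo (R : realType) (b x y : R) :
  0 <= b -> 0 <= x -> x <= y -> x `^ b <= y `^ b.
Proof.
move=> b0 x0 xy; apply: ge0_ler_powR => //; rewrite nnegrE//.
exact: le_trans xy.
Qed.

(** The fractions of [x] and [y] in [x + y] add up to 1, and a number in (0, 1] is at most its power
    with an exponent [b <= 1]. *)
Lemma powRD_le (R : realType) (b x y : R) : 0 < b <= 1 -> 0 <= x -> 0 <= y ->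
  (x + y) `^ b <= x `^ b + y `^ b.
Proof.
move=> /andP[b0 b1] x0 y0.
have [xy0|xy_neq0] := eqVneq (x + y) 0.
  by rewrite xy0 powR0 ?gt_eqF// addr_ge0 ?powR_ge0.
have xy_gt0 : 0 < x + y by rewrite lt_def xy_neq0 addr_ge0.
have part z : 0 <= z -> z <= x + y -> z / (x + y) * (x + y) `^ b <= z `^ b.
  move=> z0 zxy; have [->|z_neq0] := eqVneq z 0.
    by rewrite !mul0r powR_ge0.
  have z_gt0 : 0 < z by rewrite lt_def z_neq0.
  rewrite -{2}(divfK xy_neq0 z) powRM ?divr_ge0 ?(ltW xy_gt0)//.
  apply: ler_wpM2r; first exact: powR_ge0.
  apply: ger1_powR => //.
  by rewrite divr_gt0//= ler_pdivrMr ?mul1r.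
have := lerD (part x x0 _) (part y y0 _).
rewrite -mulrDl -mulrDl divff// mul1r; apply; first by rewrite lerDl.
by rewrite lerDr.
Qed.

Lemma powR_sum_le (R : realType) (I : Type) (s : seq I) (P : pred I) (b : R)
    (F : I -> R) : 0 < b <= 1 -> (forall i, 0 <= F i) ->
  (\sum_(i <- s | P i) F i) `^ b <= \sum_(i <- s | P i) F i `^ b.
Proof.
move=> b01 F0; elim: s => [|i s IH].
  by rewrite !big_nil powR0// gt_eqF//; case/andP: b01.
rewrite !big_cons; case: ifP => _//.
apply: le_trans (powRD_le b01 (F0 i) _) _; first exact: sumr_ge0.
by rewrite lerD2l.
Qed.

Section NestedSums.
Context {R : realType} (b : nat -> R).
Hypothesis b01 : forall i, 0 < b i <= 1.

Section OneFiltration.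
Context {W : finType} (tau : nat -> W -> W).

(* tau i is the projection to level i, and level i is encoded as the set of fixed points
   of tau i, inside the type W of the top level. *)
Fixpoint nsum (i : nat) (F : W -> R) : R :=
  match i with
  | 0 => \sum_(x | tau 0 x == x) F x
  | i'.+1 => nsum i' (fun x =>
      (\sum_(y | (tau i y == y) && (tau i' y == x)) F y) `^ b i')
  end.

Lemma nsumS i F : nsum i.+1 F = nsum i (fun x =>
  (\sum_(y | (tau i.+1 y == y) && (tau i y == x)) F y) `^ b i).
Proof. by []. Qed.

Lemma eq_nsum i F G : (forall x, tau i x = x -> F x = G x) ->
  nsum i F = nsum i G.
Proof.
elim: i F G => [|i IH] F G FG /=; first by apply: eq_bigr => x /eqP/FG.
apply: IH => x _; congr (_ `^ _).
by apply: eq_bigr => y /andP[/eqP/FG].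
Qed.

Lemma nsum_ge0 i F : (forall x, 0 <= F x) -> 0 <= nsum i F.
Proof.
elim: i F => [|i IH] F F0 /=; first by apply: sumr_ge0.
by apply: IH => x; exact: powR_ge0.
Qed.

Lemma nsum_le i F G : (forall x, 0 <= F x) ->
  (forall x, tau i x = x -> F x <= G x) -> nsum i F <= nsum i G.
Proof.
elim: i F G => [|i IH] F G F0 FG /=; first by apply: ler_sum => x /eqP/FG.
apply: IH => [x|x _]; first exact: powR_ge0.
apply: powR_homo; first by case/andP: (b01 i) => /ltW.
  by apply: sumr_ge0.
by apply: ler_sum => y /andP[/eqP/FG].
Qed.

(** All exponents are at most 1, so subadditivity of the power moves the outer sum through one level
    at a time. *)
Lemma nsum_sum_le i (I : Type) (s : seq I) (F : I -> W -> R) :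
  (forall k x, 0 <= F k x) ->
  nsum i (fun x => \sum_(k <- s) F k x) <= \sum_(k <- s) nsum i (F k).
Proof.
elim: i F => [|i IH] F F0 /=; first by rewrite exchange_big.
pose G k x := (\sum_(y | (tau i.+1 y == y) && (tau i y == x)) F k y) `^ b i.
apply: le_trans (IH G _); last by move=> k x; exact: powR_ge0.
apply: nsum_le => [x|x _]; first exact: powR_ge0.
by rewrite exchange_big/=; apply: powR_sum_le => // k; apply: sumr_ge0.
Qed.

(** The chain of projections of [x] alone contributes at least 1 at every level. *)
Lemma nsum_ge1 i F x : (forall j k y, tau j (tau k y) = tau (minn j k) y) ->
  (forall y, 0 <= F y) -> tau i x = x -> 1 <= F x -> 1 <= nsum i F.
Proof.
move=> tauE; elim: i F x => [|i IH] F x F0 ix Fx.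
  by rewrite /= (bigD1 x) ?ix//= -[leLHS]addr0 lerD// sumr_ge0.
rewrite nsumS; apply: (IH _ (tau i x)).
- by move=> y; exact: powR_ge0.
- by rewrite tauE minnn.
- have <- : 1 `^ b i = 1 :> R by rewrite powR1.
  apply: powR_homo => //; first by case/andP: (b01 i) => /ltW.
  by rewrite (bigD1 x) ?ix ?eqxx//= -[leLHS]addr0 lerD// sumr_ge0.
Qed.

(** The exponent with which a constant factor at level [j] leaves the nested sum. *)
Definition theta (j : nat) : R := \prod_(i < j) b i.

Lemma theta_gt0 j : 0 < theta j.
Proof. by apply: prodr_gt0 => i _; case/andP: (b01 i). Qed.

Lemma thetaS j : theta j.+1 = theta j * b j.
Proof. by rewrite /theta big_ord_recr. Qed.

Lemma nsumZ i c F : 0 <= c -> (forall x, 0 <= F x) ->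
  nsum i (fun x => c * F x) = c `^ theta i * nsum i F.
Proof.
elim: i c F => [|i IH] c F c0 F0 /=.
  by rewrite /theta big_ord0 powRr1// mulr_sumr.
rewrite thetaS [theta i * _]mulrC powRrM -IH ?powR_ge0//; last first.
  by move=> x; exact: powR_ge0.
apply: eq_nsum => x _; rewrite -mulr_sumr powRM//.
by apply: sumr_ge0.
Qed.

End OneFiltration.

(** At each level the fibre over a pair is the product of the two fibres, so the sums factor, and
    powers respect products. The intended [h] is the concatenation of words. *)
Lemma nsum_prod (W1 W2 W3 : finType) (t1 : nat -> W1 -> W1)
    (t2 : nat -> W2 -> W2) (t3 : nat -> W3 -> W3) (h : W1 * W2 -> W3) i F G :
  bijective h ->
  (forall j x y, t3 j (h (x, y)) = h (t1 j x, t2 j y)) ->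
  (forall x, 0 <= F x) -> (forall x, 0 <= G x) ->
  forall H, (forall x y, H (h (x, y)) = F x * G y) ->
  nsum t3 i H = nsum t1 i F * nsum t2 i G.
Proof.
move=> hbij ht; have hinj := bij_inj hbij.
elim: i F G => [|i IH] F G F0 G0 H HFG /=.
  rewrite big_distrlr pair_big/= (reindex h)/=; last exact: onW_bij.
  apply: eq_big => [[x y]|[x y] _]/=; last exact: HFG.
  by rewrite ht (inj_eq hinj).
apply: IH => [x|x|x y]; [exact: powR_ge0..|].
rewrite -powRM; [|exact: sumr_ge0..]; congr (_ `^ _).
rewrite big_distrlr pair_big/= (reindex h)/=; last exact: onW_bij.
apply: eq_big => [[x' y']|[x' y'] _]/=; last exact: HFG.
rewrite !ht !(inj_eq hinj) !xpair_eqE.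
by rewrite -!andbA; do !bool_congr.
Qed.

End NestedSums.

(** * Weights of approximate cubes *)

Section CylinderWeights.
Context {R : realType} {W : finType} (tau : nat -> W -> W) (r : nat).
Hypothesis tauE : forall i j x, tau i (tau j x) = tau (minn i j) x.
Hypothesis tau0 : forall x y, tau 0 x = tau 0 y.
Hypothesis tau_r : forall x, tau r x = x.
Variables (supp : nat -> pred W) (q : nat -> W -> R).
Hypothesis supp0 : forall z, tau 0 z = z -> supp 0 z.
Hypothesis q_ge0 : forall j y, 0 <= q j y.
Hypothesis q_sum : forall j z, (j < r)%N -> tau j z = z -> supp j z ->
  \sum_(y | (tau j.+1 y == y) && (tau j y == z)) q j y = 1.
Hypothesis q_supp : forall j y, (j < r)%N -> tau j.+1 y = y ->
  q j y != 0 -> supp j.+1 y.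

(** The [q j] are transition probabilities from level [j] to level [j.+1], normalised only over
    points of [supp]. A chain of nonzero weight never leaves [supp], so the conditional weights can
    be summed out from the top level downwards. *)
Lemma weight_sum h i z : (h <= i <= r)%N -> tau h z = z -> supp h z ->
  \sum_(y | (tau i y == y) && (tau h y == z))
    \prod_(h <= j < i) q j (tau j.+1 y) = 1.
Proof.
move=> /andP[hi]; elim: i hi => [|i IH] hi ir hz sz.
  move: hi; rewrite leqn0 => /eqP h0; subst h.
  rewrite (big_pred1 z) ?big_nil ?big_geq// => y /=.
  apply/andP/eqP => [[/eqP + /eqP]|->]; first by move=> -> ->.
  by rewrite hz.
move: hi; rewrite leq_eqVlt => /orP[/eqP h_eq|hi].
  subst h; rewrite (big_pred1 z) ?big_geq// => y /=.
  apply/andP/eqP => [[/eqP + /eqP]|->]; first by move=> -> ->.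
  by rewrite hz.
rewrite (partition_big (tau i) (fun x => (tau i x == x) && (tau h x == z)))/=.
  rewrite -[RHS](IH _ (ltnW ir) hz sz)//; apply: eq_bigr => x /andP[/eqP xi hx].
  under eq_bigr => y /andP[/andP[yi _] /eqP yx].
    rewrite big_nat_recr//= (eqP yi).
    rewrite (_ : \prod_(h <= j < i) _ = \prod_(h <= j < i) q j (tau j.+1 x)); last first.
      apply: eq_big_nat => j /andP[_ ji].
      by rewrite -yx tauE (minn_idPl ji).
    over.
  rewrite -mulr_sumr.
  rewrite [X in _ * X](eq_bigl (fun y => (tau i.+1 y == y) && (tau i y == x))); last first.
    move=> y; apply/andP/andP => [[/andP[-> _] ->]//|[-> /eqP yx]]; split; last exact/eqP.
    by rewrite -(eqP hx) -yx tauE (minn_idPl (hi : (h <= i)%N)) eqxx.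
  (* A zero prefix weight kills the term. Otherwise its last factor is nonzero and puts [x] into
     [supp]; for an empty prefix, [x] is [z]. *)
  have [->|nz] := eqVneq (\prod_(h <= j < i) q j (tau j.+1 x)) 0.
    by rewrite mul0r.
  rewrite q_sum ?mulr1//.
  move: hi; rewrite leq_eqVlt => /orP[/eqP h_eq|hi].
    by move: h_eq => [h_eq]; subst h; move: hx; rewrite xi => /eqP ->.
  case: i hi nz xi ir {IH} => // i hi nz xi ir; apply: q_supp => //.
    exact: ltnW.
  by move: nz; rewrite big_nat_recr//= mulf_eq0 negb_or xi => /andP[].
move=> y /andP[_ hy]; rewrite tauE minnn eqxx/=.
by rewrite tauE (minn_idPl (hi : (h <= i)%N)).
Qed.

(** The weight of the prefix [z] factors out, and the conditional weights of its extensions to level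
    [r] sum to 1 unless the prefix weight is 0. *)
Lemma weight_sum_le i z : (i <= r)%N -> tau i z = z ->
  \sum_(y | tau i y == z) \prod_(0 <= j < r) q j (tau j.+1 y) <=
  \prod_(0 <= j < i) q j (tau j.+1 z).
Proof.
move=> ir iz.
rewrite (eq_bigr (fun y => \prod_(0 <= j < i) q j (tau j.+1 z) *
    \prod_(i <= j < r) q j (tau j.+1 y))); last first.
  move=> y /eqP yz; rewrite (big_cat_nat (n := i))//=; congr (_ * _).
  by apply: eq_big_nat => j /andP[_ ji]; rewrite -yz tauE (minn_idPl ji).
rewrite -mulr_sumr.
have [->|nz] := eqVneq (\prod_(0 <= j < i) q j (tau j.+1 z)) 0.
  by rewrite mul0r.
have iz_supp : supp i z.
  case: i iz ir nz => [|i] iz ir nz; first exact: supp0.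
  apply: q_supp => //.
  by move: nz; rewrite big_nat_recr//= mulf_eq0 negb_or iz => /andP[].
rewrite -[leRHS]mulr1 ler_wpM2l ?prodr_ge0//.
rewrite (eq_bigl (fun y => (tau r y == y) && (tau i y == z))).
  by rewrite weight_sum ?ir /=.
by move=> y; rewrite tau_r eqxx.
Qed.

(** Different times are independent, so the total is the product over the times of the total weights
    at depth [kap k], each of which is 1. *)
Lemma cube_total n (kap : nat -> nat) : (forall k, (kap k <= r)%N) -> W ->
  \sum_(c : {ffun 'I_n -> W} | [forall k : 'I_n, tau (kap k) (c k) == c k])
     \prod_(k < n) \prod_(0 <= j < kap k) q j (tau j.+1 (c k)) = 1.
Proof.
move=> kr x0.
rewrite (eq_bigl (fun c : {ffun 'I_n -> W} =>
  c \in family (fun k : 'I_n => [pred y | tau (kap k) y == y]))).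
  rewrite -(bigA_distr_big_dep (fun k : 'I_n => [pred y | tau (kap k) y == y])
    (fun (k : 'I_n) y => \prod_(0 <= j < kap k) q j (tau j.+1 y))).
  apply: big1 => k _.
  have z00 : tau 0 (tau 0 x0) = tau 0 x0 by rewrite tauE.
  rewrite -[RHS](@weight_sum 0 (kap k) (tau 0 x0)) ?kr//; last exact: supp0.
  by apply: eq_bigl => y; rewrite inE (tau0 y x0) eqxx andbT.
move=> c; apply/forallP/familyP => cP k; have := cP k; by rewrite inE.
Qed.

(** The sum over sequences factors over the times, which reduces the claim to [weight_sum_le]. *)
Lemma cylinder_le n (kap : nat -> nat) (z : nat -> W) :
  (forall k, (kap k <= r)%N) -> 
  \sum_(c : {ffun 'I_n -> W} | [forall k : 'I_n, tau (kap k) (c k) == tau (kap k) (z k)])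
     \prod_(k < n) \prod_(0 <= j < r) q j (tau j.+1 (c k)) <=
  \prod_(k < n) \prod_(0 <= j < kap k) q j (tau j.+1 (z k)).
Proof.
move=> kr.
rewrite (eq_bigl (fun c : {ffun 'I_n -> W} =>
  c \in family (fun k : 'I_n => [pred y | tau (kap k) y == tau (kap k) (z k)]))).
  rewrite -(bigA_distr_big_dep
    (fun k : 'I_n => [pred y | tau (kap k) y == tau (kap k) (z k)])
    (fun (k : 'I_n) y => \prod_(0 <= j < r) q j (tau j.+1 y))).
  apply: ler_prod => k _; apply/andP; split.
    by apply: sumr_ge0 => y _; apply: prodr_ge0.
  rewrite -(@eq_big_nat _ _ _ 0%N (kap k)
     (fun j => q j (tau j.+1 (tau (kap k) (z k))))); last first.
    by move=> j /andP[_ jk]; rewrite tauE (minn_idPl jk).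
  by apply: weight_sum_le => //; rewrite tauE minnn.
move=> c; apply/forallP/familyP => cP k; have := cP k; by rewrite inE.
Qed.

End CylinderWeights.

(* The number of coordinates prescribed at time k in the approximate cube in which
   coordinate j < r is prescribed up to time L j.+1. *)
Definition depth (r : nat) (L : nat -> nat) (k : nat) : nat :=
  find (fun j => (L j.+1 <= k)%N) (iota 0 r).

Lemma depth_le r L k : (depth r L k <= r)%N.
Proof. by rewrite -[leqRHS](size_iota 0 r) find_size. Qed.

Lemma ltn_depth r L k j : {homo L : i j /~ (i <= j)%N} -> (j < r)%N ->
  (j < depth r L k)%N = (k < L j.+1)%N.
Proof.
move=> Lle jr; apply/idP/idP => [jd|kL].
  have := before_find 0 jd; rewrite nth_iota//= add0n => /negbT.
  by rewrite -ltnNge.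
rewrite ltnNge; apply/negP => dj.
have dr : (depth r L k < size (iota 0 r))%N by rewrite size_iota (leq_ltn_trans dj).
have := nth_find 0 (etrans (has_find _ _) dr); rewrite -/(depth r L k).
rewrite nth_iota ?add0n; last by rewrite -[ltnRHS](size_iota 0).
apply/negP; rewrite -ltnNge; apply: leq_trans kL _.
by apply: Lle; rewrite ltnS.
Qed.

(** Both sides run over the same staircase of pairs of a time and a coordinate, once by times and
    once by coordinates. *)
Lemma prod_depth (R : realType) (r n : nat) (L : nat -> nat) (F : nat -> nat -> R) :
  {homo L : i j /~ (i <= j)%N} -> (L 1 <= n)%N ->
  \prod_(k < n) \prod_(0 <= j < depth r L k) F j k =
  \prod_(j < r) \prod_(k < L j.+1) F j k.
Proof.
move=> Lle L1n.
transitivity (\prod_(k < n) \prod_(j < r | (k < L j.+1)%N) F j k).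
  apply: eq_bigr => k _; rewrite big_mkord.
  rewrite (big_ord_widen_cond r xpredT (fun j => F j k)) ?depth_le//=.
  by apply: eq_bigl => j; rewrite ltn_depth.
rewrite (exchange_big_dep xpredT)//=; apply: eq_bigr => j _.
rewrite (big_ord_widen n (fun k => F j k))//.
by apply: leq_trans L1n; apply: Lle.
Qed.

(** * Scales at which a cube has nearly optimal weight *)

Section GoodScale.
Context {R : realType} (r : nat) (b : nat -> R) (lam C : R) (p T : nat -> nat).
Hypothesis lam_gt1 : 1 < lam.
Hypothesis C_ge0 : 0 <= C.
Hypothesis p_homo : {homo p : i j /~ (i <= j)%N}.
Hypothesis p_lam : forall i, (i < r)%N -> lam ^+ p i.+1 <= b i * lam ^+ p i.
Hypothesis T_le : forall n, (T n)%:R <= lam ^+ n.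

Let G (h : nat -> nat -> R) (j : nat) : R :=
  \sum_(i < r) lam ^+ p i.+1 * \sum_(p i.+1 <= k < p i) h i (j + k)%N.

(* The sum is at least lam ^+ j times the increment at j of the bounded potential G, and
   increments of a bounded function cannot all be less than - e for long. *)
Lemma good_scale (e : R) : 0 < e -> exists K : nat,
  forall y : nat -> nat -> R, (forall i k, 0 <= y i k <= C) -> forall J : nat,
  exists2 j : nat, (J <= j < J + K)%N & - (e * lam ^+ j) <=
    \sum_(i < r) (b i * (\sum_(k < T (j + p i)) y i k)
                  - \sum_(k < T (j + p i.+1)) y i k).
Proof.
move=> e0.
have lam0 : 0 < lam by exact: lt_trans lam_gt1.
pose Gmax : R := \sum_(i < r) lam ^+ p i.+1 * ((p i)%:R * C).
have Gmax0 : 0 <= Gmax.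
  by apply: sumr_ge0 => i _; rewrite !mulr_ge0// exprn_ge0// ltW.
(* [K] decreases of size [e] would exceed the bound [Gmax] of the potential. *)
pose K := (Num.truncn (Gmax / e)).+1; exists K => y y_bnd J.
pose h i n : R := (\sum_(k < T n) y i k) / lam ^+ n.
have lamn0 n : 0 < lam ^+ n by rewrite exprn_gt0.
have hb i n : 0 <= h i n <= C.
  apply/andP; split.
    by rewrite divr_ge0 ?(ltW (lamn0 n))//; apply: sumr_ge0 => k _; case/andP: (y_bnd i k).
  rewrite ler_pdivrMr// (@le_trans _ _ (\sum_(k < T n) C))//.
    by apply: ler_sum => k _; case/andP: (y_bnd i k).
  by rewrite sumr_const card_ord -mulr_natr ler_wpM2l.
have G0 j : 0 <= G h j.
  apply: sumr_ge0 => i _; rewrite mulr_ge0 ?(ltW (lamn0 _))//.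
  by apply: sumr_ge0 => k _; case/andP: (hb i (j + k)%N).
have GM j : G h j <= Gmax.
  apply: ler_sum => i _; rewrite ler_wpM2l ?(ltW (lamn0 _))//.
  apply: (@le_trans _ _ (\sum_(p i.+1 <= k < p i) C)).
    by apply: ler_sum => k _; case/andP: (hb i (j + k)%N).
  rewrite sumr_const_nat -[C *+ _]mulr_natl; apply: ler_wpM2r => //.
  by rewrite ler_nat; exact: leq_subr.
pose F j := \sum_(i < r) (b i * (\sum_(k < T (j + p i)) y i k)
                  - \sum_(k < T (j + p i.+1)) y i k).
(* The window sums in [G] telescope to the averages at the scales [j + p i] and [j + p i.+1];
   [p_lam] raises the coefficient of the former to [b i]. *)
have GF j : lam ^+ j * (G h j.+1 - G h j) <= F j.
  rewrite -sumrB mulr_sumr; apply: ler_sum => i _.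
  rewrite -mulrBr (_ : \sum_(p i.+1 <= k < p i) h i (j.+1 + k)%N =
    \sum_(p i.+1 <= k < p i) h i (j + k.+1)%N); last first.
    by apply: eq_bigr => k _; rewrite addSnnS.
  rewrite -sumrB telescope_sumr; last exact: p_homo.
  rewrite !mulrBr lerB//; last first.
    by rewrite /h exprD mulrA [leRHS]mulrC divfK// mulf_neq0 ?gt_eqF.
  rewrite {1}/h; set s := \sum_(k < _) _.
  have s0 : 0 <= s by apply: sumr_ge0 => k _; case/andP: (y_bnd i k).
  rewrite (_ : lam ^+ j * _ = s * (lam ^+ p i.+1 / lam ^+ p i)); last first.
    by rewrite exprD; field; rewrite !gt_eqF.
  by rewrite [leRHS]mulrC ler_wpM2l// ler_pdivrMr// p_lam.
have [[j jJ Fj]|nF] := pselect (exists2 j, (J <= j < J + K)%N & - (e * lam ^+ j) <= F j).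
  by exists j.
have Gdec n : (n <= K)%N -> G h (J + n) <= G h J - e * n%:R.
  elim: n => [|n IH] nK; first by rewrite addn0 mulr0 subr0.
  have Fn : F (J + n)%N < - (e * lam ^+ (J + n)).
    rewrite ltNge; apply/negP => Fn; apply: nF; exists (J + n)%N => //.
    by rewrite leq_addr ltn_add2l.
  have := le_lt_trans (GF (J + n)%N) Fn.
  rewrite -mulNr [ltRHS]mulrC ltr_pM2l// => Gn.
  have := IH (ltnW nK); rewrite addnS -(natr1 n) => IHn.
  by rewrite mulrDr mulr1; lra.
have := Gdec K (leqnn K).
have /andP[_] := truncn_itv (divr_ge0 Gmax0 (ltW e0)).
rewrite -/K ltr_pdivrMr// => KG.
have := G0 (J + K)%N; have := GM J; lra.
Qed.

End GoodScale.

Section GoodCubes.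
Context {R : realType} (b : nat -> R).
Hypothesis b01 : forall i, 0 < b i <= 1.
Context {W : finType} (tau : nat -> W -> W) (r : nat).
Hypothesis tauE : forall i j x, tau i (tau j x) = tau (minn i j) x.
Hypothesis tau0 : forall x y, tau 0 x = tau 0 y.
Hypothesis tau_r : forall x, tau r x = x.

Let fibsum (V : nat -> W -> R) j x : R :=
  \sum_(y | (tau j.+1 y == y) && (tau j y == x)) V j.+1 y.

(** The recursion counts down from the top: [tower F k] is the partially evaluated nested sum at
    level [r - k]. *)
Fixpoint tower (F : W -> R) (k : nat) : W -> R :=
  match k with
  | 0 => F
  | k'.+1 => fun x => (\sum_(y | (tau (r - k').-1.+1 y == y) &&
        (tau (r - k').-1 y == x)) tower F k' y) `^ b (r - k').-1
  end.

Lemma tower_values F : exists V : nat -> W -> R, V r = F /\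
  forall j, (j < r)%N -> V j = fun x => fibsum V j x `^ b j.
Proof.
exists (fun j => tower F (r - j)); split=> [|j jr]; first by rewrite subnn.
rewrite /fibsum -(subnSK jr)/=; have -> : (r - (r - j.+1)).-1 = j by lia.
by [].
Qed.

Lemma nsum_values F V : V r = F ->
  (forall j, (j < r)%N -> V j = fun x => fibsum V j x `^ b j) ->
  nsum b tau r F = nsum b tau 0 (V 0).
Proof.
move=> <- VE; suff: forall n, (n <= r)%N -> nsum b tau n (V n) = nsum b tau 0 (V 0).
  by apply.
elim=> // n IH nr; rewrite -IH; last exact: ltnW.
by rewrite [V n]VE.
Qed.

Variables (B : pred W) (lam : R) (p T : nat -> nat).
Hypothesis lam_gt1 : 1 < lam.
Hypothesis p_homo : {homo p : i j /~ (i <= j)%N}.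
Hypothesis p_lam : forall i, (i < r)%N -> lam ^+ p i.+1 <= b i * lam ^+ p i.
Hypothesis T_homo : {homo T : i j / (i <= j)%N}.
Hypothesis T_le : forall n, (T n)%:R <= lam ^+ n.

Let Z := nsum b tau r (fun x => (B x)%:R).

Let L j i := T (j + p i).

(** The cubes kept at scale [j] are those of McMullen weight at least the reciprocal of the claimed
    bound, which limits their number because the total weight is 1. Along a sequence in [B] the
    logarithm of the weight is, up to a telescoping sum, the expression of [good_scale], so that
    some scale of every window is kept. *)
Lemma good_cubes (e : R) : 0 < e -> (exists x, B x) -> exists K : nat,
  exists cubes : forall j, {set {ffun 'I_(L j 1) -> W}},
  (forall j, #|cubes j|%:R <= expR ((L j 0)%:R * ln Z + e * lam ^+ j)) /\
  forall x : nat -> W, (forall k, B (x k)) -> forall J : nat,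
  exists2 j, (J <= j < J + K)%N &
    [ffun k : 'I_(L j 1) => tau (depth r (L j) k) (x k)] \in cubes j.
Proof.
move=> e0 [x0 Bx0].
have one t : 1 = 1 `^ t :> R by rewrite powR1.
have [V [Vr VE]] := tower_values (fun x => (B x)%:R).
(* The value 1 from level [r] on makes the logarithm of [Y] vanish there, so that on [B] the
   relation between [V] and [Y] extends to level [r]. *)
pose Y j x : R := if (j < r)%N then fibsum V j x else 1.
have V_ge0 j x : (j <= r)%N -> 0 <= V j x.
  by rewrite leq_eqVlt => /orP[/eqP ->|jr]; rewrite ?Vr// VE// powR_ge0.
have fib_ge0 j x : (j < r)%N -> 0 <= fibsum V j x.
  by move=> jr; apply: sumr_ge0 => y _; exact: V_ge0.
have V_ge1 x : B x -> forall j, (j <= r)%N -> 1 <= V j (tau j x).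
  move=> Bx j jr; rewrite -(subKn jr); elim: (r - j)%N (leq_subr j r) => [|m IH] mr.
    by rewrite subn0 Vr tau_r Bx.
  have jr' : (r - m.+1 < r)%N by lia.
  rewrite VE// /fibsum [leLHS](one (b (r - m.+1))).
  apply: powR_homo => //; first by case/andP: (b01 (r - m.+1)) => /ltW.
  rewrite subnSK// (bigD1 (tau (r - m) x))/=; last first.
    by rewrite !tauE minnn eqxx/=; apply/eqP; congr (tau _ x); lia.
  rewrite -[leLHS]addr0 lerD//; first by apply: IH; exact: ltnW.
  by apply: sumr_ge0 => y _; apply: V_ge0; lia.
have Y_ge1 x : B x -> forall j, 1 <= Y j (tau j x).
  move=> Bx j; rewrite /Y; case: ifP => // jr.
  have := V_ge1 x Bx j (ltnW jr); rewrite VE//.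
  rewrite leNgt => /negP V1; rewrite leNgt; apply/negP => Y1; apply: V1.
  rewrite [ltRHS](one (b j)).
  by apply: gt0_ltr_powR; rewrite ?nnegrE ?fib_ge0//; case/andP: (b01 j).
(* McMullen's weights: q j is the conditional probability of level j + 1 given level j. *)
pose q j y := if (j < r)%N then V j.+1 y / Y j (tau j y) else 0.
pose supp j := [pred z | 0 < V j z].
have supp0 z : tau 0 z = z -> supp 0%N z.
  move=> z0; rewrite /supp/= -z0 (tau0 z x0).
  by apply: lt_le_trans (V_ge1 _ Bx0 _ _).
have Y_ge0 j x : 0 <= Y j x by rewrite /Y; case: ifP => // jr; exact: fib_ge0.
have q_ge0 j y : 0 <= q j y.
  by rewrite /q; case: ifP => // jr; rewrite divr_ge0// V_ge0.
have q_sum j z : (j < r)%N -> tau j z = z -> supp j z ->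
    \sum_(y | (tau j.+1 y == y) && (tau j y == z)) q j y = 1.
  move=> jr jz; rewrite /supp/= VE// => Vz.
  have fz : fibsum V j z != 0.
    apply: contraTN Vz => /eqP ->; rewrite powR0 ?ltxx// gt_eqF//.
    by case/andP: (b01 j).
  rewrite (eq_bigr (fun y => V j.+1 y / fibsum V j z)).
    by rewrite -mulr_suml divff.
  by move=> y /andP[_ /eqP yz]; rewrite /q/Y jr yz.
have q_supp j y : (j < r)%N -> tau j.+1 y = y -> q j y != 0 -> supp j.+1 y.
  move=> jr jy; rewrite /q jr mulf_eq0 negb_or => /andP[Vy _].
  by rewrite /supp/= lt_def Vy V_ge0.
have ZE : Z = V 0%N (tau 0 x0).
  rewrite /Z -Vr (nsum_values erefl VE)/= (big_pred1 (tau 0 x0))// => x.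
  apply/eqP/eqP => [<-|->]; last by rewrite tauE.
  exact: tau0.
have Z_ge1 : 1 <= Z by rewrite ZE V_ge1.
have Z0 : 0 < Z by exact: lt_le_trans Z_ge1.
(* Since [W] is finite, a single sum bounds the logarithms of all fibre sums at all levels. *)
pose C : R := \sum_(j < r) \sum_z `|ln (Y j z)|.
have C0 : 0 <= C by apply: sumr_ge0 => j _; apply: sumr_ge0.
have [K KP] := good_scale lam_gt1 C0 p_homo p_lam T_le e0.
pose mu j (c : {ffun 'I_(L j 1) -> W}) :=
  \prod_(k < L j 1) \prod_(0 <= i < depth r (L j) k) q i (tau i.+1 (c k)).
pose bnd j := (L j 0)%:R * ln Z + e * lam ^+ j.
pose canon j := [pred c : {ffun 'I_(L j 1) -> W} |
  [forall k : 'I_(L j 1), tau (depth r (L j) k) (c k) == c k]].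
exists K, (fun j => [set c | canon j c && (expR (- bnd j) <= mu j c)]%SET); split.
  move=> j; rewrite -/(bnd j).
  have <- : \sum_(c | canon j c) mu j c * expR (bnd j) = expR (bnd j).
    rewrite -mulr_suml (cube_total tauE tau0 supp0 q_sum q_supp)// ?mul1r//.
    by move=> k; exact: depth_le.
  rewrite -sum1_card natr_sum.
  rewrite [leLHS](eq_bigl (fun c => canon j c && (expR (- bnd j) <= mu j c))); last first.
    by move=> c; rewrite inE.
  rewrite [leRHS](bigID (fun c => expR (- bnd j) <= mu j c))/=.
  rewrite -[leLHS]addr0 lerD//.
    apply: ler_sum => c /andP[_].
    by rewrite expRN -ler_pdivrMr ?expR_gt0// mul1r.
  apply: sumr_ge0 => c _; rewrite mulr_ge0 ?expR_ge0//.
  by apply: prodr_ge0 => k _; apply: prodr_ge0.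
move=> x Bx J.
pose y i k := ln (Y i (tau i (x k))).
have y_bnd i k : 0 <= y i k <= C.
  rewrite ln_ge0 ?Y_ge1//=.
  have [ir|ri] := ltnP i r; last first.
    by rewrite /y /Y ltnNge ri/= ln1.
  rewrite /C (bigD1 (Ordinal ir))//= (bigD1 (tau i (x k)))//= -addrA.
  rewrite (le_trans (ler_norm _))// lerDl addr_ge0//; first exact: sumr_ge0.
  by apply: sumr_ge0 => ? _; exact: sumr_ge0.
have [j jJ jy] := KP y y_bnd J; exists j => //.
rewrite inE; apply/andP; split.
  by rewrite /canon/=; apply/forallP => k; rewrite !ffunE tauE minnn.
have L_homo : {homo L j : i i' /~ (i <= i')%N}.
  by move=> i i' ii'; apply: T_homo; rewrite leq_add2l; exact: p_homo.
rewrite /mu.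
rewrite (eq_bigr (fun k : 'I_(L j 1) =>
   \prod_(0 <= i < depth r (L j) k) q i (tau i.+1 (x k)))); last first.
  move=> k _; apply: eq_big_nat => i /andP[_ ik].
  by rewrite ffunE tauE (minn_idPl ik).
rewrite (prod_depth r (fun i k => q i (tau i.+1 (x k))) L_homo)//.
have b0 i : 0 < b i by case/andP: (b01 i).
have lnV i k : (i <= r)%N -> ln (V i (tau i (x k))) = b i * y i k.
  rewrite leq_eqVlt /y /Y => /orP[/eqP ->|ir].
    by rewrite Vr tau_r Bx ltnn ln1 mulr0.
  by rewrite ir VE// ln_powR.
have qE i k : (i < r)%N -> q i (tau i.+1 (x k)) = expR (b i.+1 * y i.+1 k - y i k).
  move=> ir; rewrite /q ir expRD expRN -lnV// lnK; last first.
    by rewrite posrE (lt_le_trans _ (V_ge1 _ (Bx k) _ _)).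
  rewrite /y lnK; last by rewrite posrE (lt_le_trans _ (Y_ge1 _ (Bx k) _)).
  by rewrite tauE (minn_idPl (leqnSn i)).
rewrite (eq_bigr (fun i : 'I_r => expR (\sum_(k < L j i.+1) (b i.+1 * y i.+1 k - y i k)))).
  rewrite -expR_sum ler_expR.
  pose S i n := \sum_(k < n) y i k.
  (* Adding and subtracting [b i * S i (L j i)] leaves the expression of [good_scale] and a
     telescoping sum, whose value is minus [(L j 0)%:R * ln Z]. *)
  have -> : \sum_(i < r) \sum_(k < L j i.+1) (b i.+1 * y i.+1 k - y i k) =
    \sum_(i < r) (b i * S i (L j i) - S i (L j i.+1)) +
    \sum_(0 <= i < r) (b i.+1 * S i.+1 (L j i.+1) - b i * S i (L j i)).
    rewrite big_mkord -big_split; apply: eq_bigr => i _/=.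
    rewrite sumrB -mulr_sumr -/(S i.+1 (L j i.+1)) -/(S i (L j i.+1)).
    by rewrite addrC addrA subrK.
  rewrite telescope_sumr//.
  have -> : b r * S r (L j r) = 0.
    by rewrite /S big1 ?mulr0// => k _; rewrite /y /Y ltnn ln1.
  have -> : b 0 * S 0 (L j 0) = (L j 0)%:R * ln Z.
    rewrite /S mulr_sumr (eq_bigr (fun=> ln Z)).
      by rewrite sumr_const card_ord mulr_natl.
    by move=> k _; rewrite -lnV// ZE (tau0 (x k) x0).
  by rewrite /bnd opprD addrC sub0r lerD2r.
by move=> i _; rewrite expR_sum; apply: eq_bigr => k _; rewrite qE.
Qed.

End GoodCubes.

(** * Homogeneous subsets and the mass distribution principle *)

Section Homogenize.
Context {R : realType} (b : nat -> R).
Hypothesis b01 : forall i, 0 < b i <= 1.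
Context {W : finType} (tau : nat -> W -> W).
Hypothesis tauE : forall i j x, tau i (tau j x) = tau (minn i j) x.
Hypothesis tau0 : forall x y, tau 0 x = tau 0 y.

Definition shadow (i : nat) (H : pred W) (j : nat) : pred W :=
  fun y => [exists z, [&& tau i z == z, H z & tau j z == y]].

Definition branching (i : nat) (H : pred W) (j : nat) (x : W) : nat :=
  #|[pred y | [&& tau j.+1 y == y, tau j y == x & shadow i H j.+1 y]]|.

Let K := (trunc_log 2 #|W|).+1.

Lemma nsum_nat0 i (P : pred W) : 0 < nsum b tau i (fun x => (P x)%:R) ->
  exists2 x, tau i x = x & P x.
Proof.
move=> P0; have [//|nP] := pselect (exists2 x, tau i x = x & P x).
suff P00 : nsum b tau i (fun x => (P x)%:R) = 0 by rewrite P00 ltxx in P0.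
rewrite (@eq_nsum _ _ _ _ _ _ (fun x => 0 * (P x)%:R)).
  by rewrite nsumZ// powR0 ?mul0r// gt_eqF// theta_gt0.
move=> x ix; rewrite mul0r; case Px: (P x) => //.
by exfalso; apply: nP; exists x.
Qed.

(** The term in which [k] is the integer part of the binary logarithm of [f] suffices, as [f] is
    below [2 * 2 ^ k]. For [f = 0] the left-hand side vanishes because [c] is positive. *)
Lemma dyadic_powR_le (f n : nat) (c : R) : 0 < c -> (f <= n)%N ->
  f%:R `^ c <= \sum_(k < (trunc_log 2 n).+1) (2 * 2 ^ k)%:R `^ c * (2 ^ k <= f)%N%:R.
Proof.
move=> c0 fn; have [->|f_gt0] := posnP f.
  by rewrite powR0 ?gt_eqF//; apply: sumr_ge0 => k _; rewrite mulr_ge0 ?powR_ge0.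
have kK : (trunc_log 2 f < (trunc_log 2 n).+1)%N by rewrite ltnS leq_trunc_log.
have /andP[lo hi] := trunc_log_bounds (erefl : (1 < 2)%N) f_gt0.
rewrite (bigD1 (Ordinal kK))//= lo mulr1 -[leLHS]addr0 lerD//.
  by apply: powR_homo => //; [exact: ltW|rewrite ler_nat -expnS ltnW].
by apply: sumr_ge0 => k _; rewrite mulr_ge0 ?powR_ge0.
Qed.

(** Among [K] dyadic thresholds for the size of the fibres over level [i], one dominates the nested
    sum up to the factor [K]. The base points above this threshold are homogenised by induction and
    lifted back to [P]. The 2 in the bound comes from rounding a fibre size down to a power of 2. *)
Lemma homogenize i (P : pred W) : 0 < nsum b tau i (fun x => (P x)%:R) ->
  exists (H : pred W) (N : nat -> nat),
    [/\ subpred H P, exists2 x, tau i x = x & H x,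
     forall j, (0 < N j)%N,
     forall j x, (j < i)%N -> tau i x = x -> H x ->
       (N j <= branching i H j (tau j x))%N
     & nsum b tau i (fun x => (P x)%:R) <=
       \prod_(j < i) (K%:R * (2 * N j)%:R `^ theta b j.+1)].
Proof.
elim: i P => [|i IH] P P0.
  exists P, (fun=> 1%N); split=> //.
    exact: nsum_nat0.
  have [x0 x00 _] := nsum_nat0 P0.
  rewrite big_ord0/= (big_pred1 x0)=> [|x]; first by rewrite lern1 leq_b1.
  by apply/eqP/eqP => [<-|->]//; rewrite -x00; exact: tau0.
pose f x := #|[pred y | [&& tau i.+1 y == y, tau i y == x & P y]]|.
pose Pk k : pred W := fun x => (2 ^ k <= f x)%N.
pose S k := nsum b tau i (fun x => (Pk k x)%:R).
have S_ge0 k : 0 <= S k by exact: nsum_ge0.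
have bi0 : 0 < b i by case/andP: (b01 i).
have PS : nsum b tau i.+1 (fun x => (P x)%:R) <=
    \sum_(k < K) (2 * 2 ^ k)%:R `^ theta b i.+1 * S k.
  rewrite /=; apply: (@le_trans _ _ (nsum b tau i (fun x =>
      \sum_(k < K) (2 * 2 ^ k)%:R `^ b i * (Pk k x)%:R))).
    apply: nsum_le => // [x|x _]; first exact: powR_ge0.
    rewrite (_ : \sum_(y | _) _ = (f x)%:R).
      by apply: dyadic_powR_le => //; exact: max_card.
    rewrite -natr_sum; congr _%:R; rewrite /f -sum1_card.
    rewrite big_mkcond [RHS]big_mkcond; apply: eq_bigr => y _ /=.
    by rewrite inE andbA; case: (_ && _) => //=; case: (P y).
  apply: le_trans (nsum_sum_le b01 _ _ _ _) _.
    by move=> k x; rewrite mulr_ge0// powR_ge0.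
  apply: ler_sum => k _; rewrite nsumZ// ?powR_ge0//.
  by rewrite -powRrM [b i * _]mulrC -thetaS.
(* Pigeonhole: the threshold with the largest contribution is taken. *)
have [k PSk] : exists k : 'I_K, nsum b tau i.+1 (fun x => (P x)%:R) <=
    K%:R * ((2 * 2 ^ k)%:R `^ theta b i.+1 * S k).
  pose v (k : 'I_K) := (2 * 2 ^ k)%:R `^ theta b i.+1 * S k.
  have [k _ kmax] := @arg_maxP _ _ _ (ord0 : 'I_K) xpredT v isT.
  exists k; apply: (le_trans PS).
  rewrite (le_trans (ler_sum _ (fun k' _ => kmax k' isT)))//.
  by rewrite sumr_const card_ord mulr_natl.
have Sk0 : 0 < S k.
  rewrite lt_def S_ge0 andbT; apply/eqP => Sk.
  by move: (lt_le_trans P0 PSk); rewrite Sk !mulr0 ltxx.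
have [H [N [HP [x ix Hx] N0 Hbr SN]]] := IH _ Sk0.
have fibre z : Pk k z -> exists2 y, tau i.+1 y = y & tau i y = z /\ P y.
  move=> Pz; have : (0 < f z)%N by apply: leq_trans Pz; rewrite expn_gt0.
  by case/card_gt0P => y; rewrite inE => /and3P[/eqP ? /eqP ? ?]; exists y.
pose H' : pred W := fun y => P y && H (tau i y).
(* Every point of [H] at level [i] has a preimage in [H'], so lifting loses no shadow at lower
   levels and the branching numbers there stay bounded below. *)
have shH j y : (j <= i)%N -> shadow i H j y -> shadow i.+1 H' j y.
  move=> ji /existsP[z /and3P[/eqP iz Hz /eqP zy]].
  have [w iw [wz Pw]] := fibre z (HP _ Hz).
  apply/existsP; exists w; rewrite iw eqxx/= /H' Pw wz Hz/= -zy -wz tauE.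
  by rewrite (minn_idPl ji).
exists H', (fun j => if j == i then (2 ^ k)%N else N j); split.
- by move=> y /andP[].
- by have [w iw [wx Pw]] := fibre x (HP _ Hx); exists w; rewrite // /H' Pw wx.
- by move=> j; case: ifP; rewrite ?expn_gt0.
- move=> j y; rewrite ltnS leq_eqVlt => /orP[/eqP ->|ji] iy /andP[Py Hy].
    rewrite eqxx; apply: leq_trans (HP _ Hy) _.
    apply: subset_leq_card; apply/fintype.subsetP => w; rewrite !inE.
    move=> /and3P[iw wy Pw]; rewrite iw wy/=; apply/existsP; exists w.
    by rewrite iw/= /H' Pw (eqP wy) Hy.
  rewrite ltn_eqF//.
  have ity : tau i (tau i y) = tau i y by rewrite tauE minnn.
  have := Hbr j (tau i y) ji ity Hy.
  rewrite tauE (minn_idPl (ltnW ji)) => /leq_trans; apply.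
  apply: subset_leq_card; apply/fintype.subsetP => w; rewrite !inE.
  by move=> /and3P[-> -> sw]; rewrite shH.
- rewrite big_ord_recr/= eqxx; apply: (le_trans PSk).
  rewrite mulrA mulrC; apply: ler_wpM2r; first by rewrite mulr_ge0 ?powR_ge0.
  apply: (le_trans SN); apply: ler_prod => j _.
  by rewrite ltn_eqF// mulr_ge0 ?powR_ge0/=.
Qed.


End Homogenize.

(* This compactness argument makes finitely additive weights of finite words sufficient
   for the mass distribution principle: no measure on sequences is needed. *)
Lemma koenig (W : finType) (H : pred W) (E : nat -> set (nat -> W))
    (len : nat -> nat) :
  (forall k x y, E k x -> (forall i, (i < len k)%N -> y i = x i) -> E k y) ->
  (forall x, (forall i, H (x i)) -> exists k, E k x) ->
  exists n, forall x, (forall i, H (x i)) -> exists2 k, (k < n)%N & E k x.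
Proof.
move=> Elen Ecov.
have [x0 Hx0|H0] := pickP H; last first.
  by exists 0 => x Hx; have := Hx 0; rewrite H0.
pose ext (w : seq W) (x : nat -> W) :=
  (forall i, H (x i)) /\ forall i, (i < size w)%N -> x i = nth x0 w i.
pose covered w n := forall x, ext w x -> exists2 k, (k < n)%N & E k x.
have [[n nP]|bad0] := pselect (exists n, covered [::] n).
  by exists n => x Hx; apply: nP.
(* Otherwise the bad words, those whose extensions are not covered by finitely many [E k], can be
   prolonged forever. *)
pose bad w := ~ exists n, covered w n.
pose badT := {w : seq W | bad w}.
pose step (u v : badT) := exists2 a, H a & sval v = rcons (sval u) a.
have stepP (u : badT) : {v : badT | step u v}.
  apply: cid; case: u => w wbad.
  have [[a Ha abad]|good] := pselect (exists2 a, H a & ~ exists n, covered (rcons w a) n).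
    by exists (exist bad _ abad), a.
  exfalso; apply: wbad.
  (* The alphabet is finite: if all extensions by a letter were good, the largest of their bounds
     would serve for [w]. *)
  have nP a : exists n, H a -> covered (rcons w a) n.
    have [Ha|nHa] := pselect (H a); last by exists 0%N.
    have [[n nP]|nn] := pselect (exists n, covered (rcons w a) n); first by exists n.
    by exfalso; apply: good; exists a.
  pose N a := sval (cid (nP a)).
  exists (\max_a N a) => x [Hx wx].
  have [] := svalP (cid (nP (x (size w)))) (Hx _) x.
    split=> // i; rewrite size_rcons ltnS nth_rcons leq_eqVlt => /orP[/eqP ->|iw].
      by rewrite ltnn eqxx.
    by rewrite iw wx.
  move=> k kN Ek; exists k => //; apply: leq_trans kN _.
  exact: (@leq_bigmax _ N).
have [u [u0 uS]] := dependent_choice stepP (exist bad _ bad0).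
have usz n : size (sval (u n)) = n.
  elim: n => [|n IH]; first by rewrite u0.
  by have [a _ ->] := uS n; rewrite size_rcons IH.
pose x n := nth x0 (sval (u n.+1)) n.
have xE n i : (i < n)%N -> nth x0 (sval (u n)) i = x i.
  elim: n => // n IH; rewrite ltnS leq_eqVlt => /orP[/eqP ->//|ltin].
  by have [a _ ->] := uS n; rewrite nth_rcons usz ltin IH.
have Hx n : H (x n).
  by rewrite /x; have [a Ha ->] := uS n; rewrite nth_rcons usz ltnn eqxx.
(* The limit branch lies in some [E k], which depends on [len k] letters only, so the prefix of that
   length cannot be bad. *)
have [k Ek] := Ecov x Hx.
exfalso; apply: (svalP (u (len k))); exists k.+1 => y [Hy ywk].
exists k => //; apply: Elen Ek _ => i ik.
by rewrite ywk ?usz// xE.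
Qed.

Section MassDistribution.
Context {R : realType} {W : finType} (tau : nat -> W -> W) (r : nat).
Hypothesis tauE : forall i j x, tau i (tau j x) = tau (minn i j) x.
Hypothesis tau0 : forall x y, tau 0 x = tau 0 y.
Hypothesis tau_r : forall x, tau r x = x.
Variables (H : pred W) (N : nat -> nat).
Hypothesis H_neq0 : exists x, H x.
Hypothesis N_gt0 : forall j, (0 < N j)%N.
Hypothesis H_branching : forall j x, (j < r)%N -> H x ->
  (N j <= branching tau r H j (tau j x))%N.

(** Splitting mass uniformly over the branches of [H] gives every cylinder of shape [L k] at most
    the weight of the inner product. By compactness finitely many [k] suffice to cover, and together
    their cylinders carry the full mass 1. *)
Lemma mass_distribution (V : finType) (L : nat -> nat -> nat)
    (z : nat -> V -> nat -> W) :
  (forall k, {homo L k : i j /~ (i <= j)%N}) ->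
  (forall x, (forall i, H (x i)) -> exists k v, forall i,
     tau (depth r (L k) i) (x i) = tau (depth r (L k) i) (z k v i)) ->
  exists n, 1 <= \sum_(k < n) \sum_(v : V)
    \prod_(j < r) ((N j)%:R^-1 : R) ^+ L k j.+1.
Proof.
move=> L_homo cov; have [x0 Hx0] := H_neq0.
pose E k (x : nat -> W) := exists v, forall i,
     tau (depth r (L k) i) (x i) = tau (depth r (L k) i) (z k v i).
have depth0 k i : (L k 1 <= i)%N -> depth r (L k) i = 0%N.
  move=> ki; apply/eqP; rewrite -leqn0 leqNgt; apply/negP => d0.
  have r0 : (0 < r)%N by apply: leq_trans d0 (depth_le _ _ _).
  by move: d0; rewrite ltn_depth// ltnNge ki.
have [||n nP] := @koenig W H E (fun k => L k 1%N).
- move=> k x y [v xv] yx; exists v => i.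
  have [ik|ki] := ltnP i (L k 1%N); first by rewrite yx.
  by rewrite depth0//; exact: tau0.
- by move=> x /cov [k [v kv]]; exists k, v.
exists n.
pose q j y : R := (shadow tau r H j.+1 y)%:R / (branching tau r H j (tau j y))%:R.
have q_ge0 j y : 0 <= q j y by rewrite divr_ge0.
have sh_tau j y : shadow tau r H j y -> tau j y = y.
  by move=> /existsP[w /and3P[_ _ /eqP <-]]; rewrite tauE minnn.
have shP j y : shadow tau r H j y -> exists2 x, H x & tau j x = y.
  by move=> /existsP[x /and3P[_ Hx /eqP xy]]; exists x.
have shI j x : H x -> shadow tau r H j (tau j x).
  by move=> Hx; apply/existsP; exists x; rewrite tau_r Hx !eqxx.
have br_gt0 j x : (j < r)%N -> H x -> (0 < branching tau r H j (tau j x))%N.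
  by move=> jr Hx; apply: leq_trans (H_branching jr Hx).
have q_sum j y : (j < r)%N -> tau j y = y -> shadow tau r H j y ->
    \sum_(w | (tau j.+1 w == w) && (tau j w == y)) q j w = 1.
  move=> jr jy /shP[x Hx xy].
  rewrite (eq_bigr (fun w => (shadow tau r H j.+1 w)%:R / (branching tau r H j y)%:R)).
    rewrite -mulr_suml (_ : \sum_(w | _) _ = (branching tau r H j y)%:R).
      by rewrite divff// pnatr_eq0 -lt0n -xy br_gt0.
    rewrite -natr_sum; congr _%:R; rewrite /branching -sum1_card.
    rewrite big_mkcond [RHS]big_mkcond; apply: eq_bigr => w _ /=.
    by rewrite inE andbA; case: (_ && _) => //=; case: (shadow _ _ _ _ _).
  by move=> w /andP[_ /eqP wy]; rewrite /q wy.
have q_supp j y : (j < r)%N -> tau j.+1 y = y -> q j y != 0 -> shadow tau r H j.+1 y.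
  by move=> jr jy; rewrite /q; case: (shadow _ _ _ _ _) => //; rewrite mul0r eqxx.
have supp0 y : tau 0 y = y -> shadow tau r H 0 y.
  by move=> y0; rewrite -y0 (tau0 y x0) shI.
have q_le j y : (j < r)%N -> q j y <= (N j)%:R^-1.
  move=> jr; rewrite /q; case sh: (shadow _ _ _ _ _); last by rewrite mul0r.
  have [x Hx xy] := shP _ _ sh.
  rewrite div1r lef_pV2 ?posrE ?ltr0n// -xy tauE (minn_idPl (leqnSn j)) ?br_gt0//.
  by rewrite ler_nat H_branching.
(* A time horizon beyond which the cylinders with [k < n] prescribe nothing. *)
pose n' := \max_(k < n) L k 1%N.
pose wt (c : {ffun 'I_n' -> W}) := \prod_(k < n') \prod_(0 <= j < r) q j (tau j.+1 (c k)).
have wt0 c : 0 <= wt c by apply: prodr_ge0 => k _; apply: prodr_ge0.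
have tot : \sum_c wt c = 1.
  rewrite -[RHS](cube_total tauE tau0 supp0 q_sum q_supp n' (kap := fun=> r))//.
  by apply: eq_bigl => c; apply/esym/forallP => k; rewrite tau_r.
rewrite -[leLHS]tot.
pose cyl k v := [pred c : {ffun 'I_n' -> W} | [forall i : 'I_n',
  tau (depth r (L k) i) (c i) == tau (depth r (L k) i) (z k v i)]].
apply: (@le_trans _ _ (\sum_c \sum_(k < n) \sum_v if cyl k v c then wt c else 0)).
  apply: ler_sum => c _; set s := \sum_(k < n) _.
  have s0 : 0 <= s.
    by apply: sumr_ge0 => k _; apply: sumr_ge0 => v _; case: ifP.
  have [->//|wtc] := eqVneq (wt c) 0.
  have cH i : H (c i).
    have [r0|r0] := posnP r.
      by rewrite -(tau_r (c i)) r0 (tau0 _ x0) -r0 tau_r.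
    have : shadow tau r H r (c i).
      move: wtc; rewrite /wt (bigD1 i)//= mulf_eq0 negb_or => /andP[+ _].
      case: r r0 tau_r q_supp => // r' _ tau_r' q_supp'.
      rewrite big_nat_recr//= mulf_eq0 negb_or tau_r' => /andP[_].
      by move=> /q_supp'; rewrite tau_r' => ->.
    by move=> /shP[x Hx]; rewrite tau_r => <-.
  (* The times past the horizon may be filled with any element of [H]. *)
  pose x i := if insub i is Some i' then c i' else x0.
  have xc (i : 'I_n') : x i = c i by rewrite /x valK.
  have [|k kn [v kv]] := nP x.
    by move=> i; rewrite /x; case: insubP.
  rewrite /s (bigD1 (Ordinal kn))//= (bigD1 v)//= ifT; last first.
    by apply/forallP => i; rewrite -xc kv.
  rewrite -addrA lerDl addr_ge0//; first by apply: sumr_ge0 => ? _; case: ifP.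
  by apply: sumr_ge0 => ? _; apply: sumr_ge0 => ? _; case: ifP.
rewrite exchange_big/=; apply: ler_sum => k _.
rewrite exchange_big/=; apply: ler_sum => v _.
rewrite -big_mkcond/=.
have cl := cylinder_le tauE tau_r supp0 q_ge0 q_sum q_supp n' (z k v)
  (kap := depth r (L k)) (depth_le _ _).
apply: (le_trans cl).
rewrite (prod_depth r (fun j i => q j (tau j.+1 (z k v i))) (L_homo k)); last first.
  exact: (@leq_bigmax _ (fun k : 'I_n => L k 1%N)).
apply: ler_prod => j _; rewrite prodr_ge0//=.
rewrite -[X in _ ^+ X]card_ord -prodr_const; apply: ler_prod => i _.
by rewrite q_ge0 q_le.
Qed.

End MassDistribution.

(** * Words *)

Section Truncation.
Variables (m : nat -> nat) (r : nat) (d0 : D m r).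

(** Coordinates from [i] on are reset to those of [d0], which realises all levels inside one type,
    as [nsum] requires. *)
Definition trunc (i : nat) (d : D m r) : D m r :=
  [ffun j : 'I_r => if (j < i)%N then d j else d0 j].

Definition tauw (N i : nat) (x : N.-tuple (D m r)) : N.-tuple (D m r) :=
  map_tuple (trunc i) x.

Lemma truncE i j d : trunc i (trunc j d) = trunc (minn i j) d.
Proof.
apply/ffunP => k; rewrite !ffunE leq_min.
by case: (k < i)%N; case: (k < j)%N.
Qed.

Lemma tauwE N i j (x : N.-tuple (D m r)) : tauw i (tauw j x) = tauw (minn i j) x.
Proof. by apply/eq_from_tnth => k; rewrite !tnth_map truncE. Qed.

Lemma tauw0 N (x y : N.-tuple (D m r)) : tauw 0 x = tauw 0 y.
Proof.
by apply/eq_from_tnth => k; rewrite !tnth_map; apply/ffunP => j; rewrite !ffunE.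
Qed.

Lemma tauw_r N (x : N.-tuple (D m r)) : tauw r x = x.
Proof.
apply/eq_from_tnth => k; rewrite !tnth_map; apply/ffunP => j.
by rewrite !ffunE ltn_ord.
Qed.

Lemma tauw_eqP N i (x y : N.-tuple (D m r)) : tauw i x = tauw i y <->
  forall k (j : 'I_r), (j < i)%N -> tnth x k j = tnth y k j.
Proof.
split=> [xy k j ji|xy].
  have /(congr1 (fun d : D m r => d j)) := congr1 (fun t => tnth t k) xy.
  by rewrite !tnth_map !ffunE ji.
apply/eq_from_tnth => k; rewrite !tnth_map; apply/ffunP => j; rewrite !ffunE.
by case: ifP => // /xy ->.
Qed.

Definition proj (i : nat) (ir : (i <= r)%N) (d : D m r) : D m i :=
  [ffun j : 'I_i => d (widen_ord ir j)].

Definition ext (i : nat) (d : D m i) : D m r :=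
  [ffun j : 'I_r => match decP (@idP (j < i)%N) with
                    | left h => d (Ordinal h)
                    | right _ => d0 j
                    end].

Lemma extK i (ir : (i <= r)%N) : cancel (@ext i) (proj ir).
Proof.
move=> d; apply/ffunP => -[j ji]; rewrite !ffunE.
case: decP => [/= h|/negP]; last by rewrite /= ji.
by rewrite (bool_irrelevance h ji).
Qed.

Lemma projK i (ir : (i <= r)%N) d : ext (proj ir d) = trunc i d.
Proof.
apply/ffunP => -[j jr]; rewrite !ffunE; case: decP => [/= h|/negP/negbTE ->//].
rewrite h ffunE /widen_ord/=.
by rewrite (bool_irrelevance (widen_ord_proof (Ordinal h) ir) jr).
Qed.

End Truncation.

Section NestedSumConversion.
Variables (R : realType) (m : nat -> nat) (r : nat) (d0 : D m r) (N : nat).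

Definition projw (i : nat) (ir : (i <= r)%N) (x : N.-tuple (D m r)) : word m i N :=
  map_tuple (proj ir) x.

Definition extw (i : nat) (s : word m i N) : N.-tuple (D m r) :=
  map_tuple (@ext m r d0 i) s.

Lemma extwK i (ir : (i <= r)%N) : cancel (@extw i) (projw ir).
Proof. by move=> s; apply/eq_from_tnth => k; rewrite !tnth_map extK. Qed.

Lemma projwK i (ir : (i <= r)%N) x : extw (projw ir x) = tauw d0 i x.
Proof. by apply/eq_from_tnth => k; rewrite !tnth_map projK. Qed.

Lemma projw_tauw i (ir : (i <= r)%N) x : projw ir (tauw d0 i x) = projw ir x.
Proof. by rewrite -projwK (extwK ir). Qed.

Lemma forget_projw i (ir : (i.+1 <= r)%N) x :
  forget_word (projw ir x) = projw (ltnW ir) x :> word m i N.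
Proof.
apply/eq_from_tnth => k; rewrite !tnth_map; apply/ffunP => -[j ji]; rewrite !ffunE.
rewrite /widen_ord/=.
set p := widen_ord_proof _ ir.
by rewrite (bool_irrelevance p (widen_ord_proof (Ordinal ji) (ltnW ir))).
Qed.

Lemma big_fibre i (ir : (i.+1 <= r)%N) (F : word m i.+1 N -> R) x :
  tauw d0 i x = x ->
  \sum_(s : word m i.+1 N | forget_word s == projw (ltnW ir) x :> word m i N) F s =
  \sum_(y | (tauw d0 i.+1 y == y) && (tauw d0 i y == x)) F (projw ir y).
Proof.
move=> ix; rewrite (reindex_onto (projw ir) (@extw i.+1)); last first.
  by move=> s _; rewrite extwK.
apply: eq_bigl => y; rewrite projwK andbC forget_projw; congr (_ && _).
apply/eqP/eqP => [yx|<-]; last by rewrite projw_tauw.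
by rewrite -(projwK (ltnW ir)) yx projwK.
Qed.

(** [nsum] starts from a level 0 with a single point, [nested_sum] from level 1; the exponent
    [b 0 = 1] makes the extra level harmless. *)
Lemma nested_nsum (a b : nat -> R) i (ir : (i.+1 <= r)%N) (F : word m i.+1 N -> R) :
  (forall s, 0 <= F s) -> b 0 = 1 -> (forall j, (0 < j < r)%N -> b j = a j) ->
  nested_sum a F = nsum b (tauw d0 (N := N)) i.+1 (F \o projw ir).
Proof.
move=> F0 b0 ba; elim: i ir F F0 => [|i IH] ir F F0.
  rewrite /= b0.
  pose x0 : N.-tuple (D m r) := [tuple d0 | _ < N].
  have x00 : tauw d0 0 x0 = x0.
    by apply/eq_from_tnth => k; rewrite !tnth_map; apply/ffunP => j; rewrite !ffunE.
  rewrite (big_pred1 x0) => [|x /=]; last first.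
    by apply/eqP/eqP => [<-|->//]; rewrite -x00; exact: tauw0.
  rewrite powRr1; last exact: sumr_ge0.
  rewrite -big_fibre//; apply: eq_bigl => s; apply/esym/eqP.
  by apply/eq_from_tnth => k; apply/ffunP => -[].
have -> : nested_sum a F = nested_sum a (fun s : word m i.+1 N =>
  (\sum_(s' : word m i.+2 N | forget_word s' == s) F s') `^ a i.+1) by [].
rewrite [RHS]nsumS (IH (ltnW ir)); last by move=> s; exact: powR_ge0.
by apply: eq_nsum => x ix; rewrite /comp ba// big_fibre.
Qed.

End NestedSumConversion.

Section WordSums.
Variables (R : realType) (m : nat -> nat) (r : nat) (d0 : D m r) (b : nat -> R).
Hypothesis b01 : forall i, 0 < b i <= 1.

(** With the exponents [expo], this is the quantity Z of the overview. Predicates on sequences serve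
    all word lengths at once. *)
Definition wsum (N : nat) (P : pred (seq (D m r))) : R :=
  nsum b (tauw d0 (N := N)) r (fun x => (P x)%:R).

Lemma wsum_ge0 N P : 0 <= wsum N P.
Proof. exact: nsum_ge0. Qed.

Lemma wsum_le N (P Q : pred (seq (D m r))) :
  (forall x, size x = N -> P x -> Q x) -> wsum N P <= wsum N Q.
Proof.
move=> PQ; apply: nsum_le => // x _; rewrite ler_nat.
have := PQ x (size_tuple x); case: (P x) => // /(_ isT) -> //.
Qed.

Lemma wsum_union N (I : finType) (P : pred (seq (D m r)))
    (Q : I -> pred (seq (D m r))) :
  (forall x, size x = N -> P x -> exists i, Q i x) ->
  wsum N P <= \sum_i wsum N (Q i).
Proof.
move=> PQ; apply: le_trans (nsum_sum_le b01 _ _ _ _) => //.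
apply: nsum_le => // x _; case Px: (P x); last exact: sumr_ge0.
have [i Qi] := PQ x (size_tuple x) Px.
by rewrite (bigD1 i)//= Qi lerDl sumr_ge0.
Qed.

(** Concatenation is a bijection that commutes with truncation. *)
Lemma wsum_cat p q (P Q : pred (seq (D m r))) :
  wsum (p + q) (fun x => P (take p x) && Q (drop p x)) = wsum p P * wsum q Q.
Proof.
pose h (xy : p.-tuple (D m r) * q.-tuple (D m r)) := [tuple of xy.1 ++ xy.2].
apply: (@nsum_prod _ b _ _ _ _ _ _ h) => //.
- apply: inj_card_bij.
    move=> [x y] [x' y'] /(congr1 val)/= /eqP.
    by rewrite eqseq_cat ?size_tuple// => /andP[/eqP/val_inj -> /eqP/val_inj ->].
  by rewrite card_prod !card_tuple expnD.
- by move=> j x y; apply: val_inj; rewrite /= map_cat.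
- move=> x y /=; rewrite take_size_cat ?size_tuple// drop_size_cat ?size_tuple//.
  by case: (P x); case: (Q y); rewrite /= ?mulr0 ?mulr1.
Qed.

End WordSums.

(** * Expansions and the metric of the torus *)

Section Digits.
Context {R : realType} (M : nat) (e : nat -> nat).
Hypothesis M_gt1 : (1 < M)%N.
Hypothesis e_lt : forall k, (e k < M)%N.

(** The integer with base-[M] digits [f 0], ..., [f n.-1], most significant first. *)
Fixpoint digpref (f : nat -> nat) (n : nat) : nat :=
  if n is n'.+1 then digpref f n' * M + f n' else 0.

Definition digval (f : nat -> nat) : R :=
  limn (series (fun k => (f k)%:R * M%:R ^- k.+1 : R)).

Lemma digpref_lt n : (digpref e n < M ^ n)%N.
Proof.
elim: n => [|n IH]; first by rewrite expn0.
have := e_lt n; rewrite /= expnS; nia.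
Qed.

Lemma series_digpref n :
  series (fun k => (e k)%:R * M%:R ^- k.+1 : R) n = (digpref e n)%:R / M%:R ^+ n.
Proof.
have M0 : M%:R != 0 :> R by rewrite pnatr_eq0; lia.
elim: n => [|n IH]; first by rewrite /series/= big_geq// mul0r.
rewrite seriesSr IH /= natrD natrM exprS; field.
by rewrite expf_neq0.
Qed.

Let u := series (fun k => (e k)%:R * M%:R ^- k.+1 : R).

Let M0 : 0 < M%:R :> R. Proof. by rewrite ltr0n; lia. Qed.

Let u_homo : nondecreasing_seq u.
Proof.
apply/nondecreasing_seqP => n; rewrite /u seriesSr lerDl.
by rewrite mulr_ge0// invr_ge0 exprn_ge0.
Qed.

Let u_ub n k : u k <= (digpref e n).+1%:R / M%:R ^+ n.
Proof.
apply: (@le_trans _ _ (u (n + k)%N)); first by apply: u_homo; exact: leq_addl.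
rewrite /u series_digpref.
suff H : ((digpref e (n + k)).+1 <= (digpref e n).+1 * M ^ k)%N.
  rewrite ler_pdivrMr ?exprn_gt0// exprD mulrA divfK ?gt_eqF ?exprn_gt0//.
  rewrite -natrX -natrM ler_nat; exact: ltnW.
elim: k => [|k IH]; first by rewrite addn0 muln1.
rewrite addnS/= expnS; have := e_lt (n + k); nia.
Qed.

Let u_cvg : cvgn u.
Proof.
apply: nondecreasing_is_cvgn => //.
by exists (1 : R) => _ [k _ <-]; have := u_ub 0 k; rewrite expr0 divr1.
Qed.

(** Appending a digit never pushes the successor of the prefix beyond [M] times its old value, so
    the tail adds at most one unit of place [n]. The upper bound is not strict: all later digits may
    be [M - 1]. *)
Lemma digval_bounds n :
  (digpref e n)%:R / M%:R ^+ n <= digval e <= (digpref e n).+1%:R / M%:R ^+ n.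
Proof.
rewrite -series_digpref; apply/andP; split.
  exact: (nondecreasing_cvgn_le u_homo u_cvg).
apply: limr_le => //; apply: nearW => k; exact: u_ub.
Qed.

End Digits.

Lemma eq_digpref M (f g : nat -> nat) n :
  (forall k, (k < n)%N -> f k = g k) -> digpref M f n = digpref M g n.
Proof.
elim: n => //= n IH fg; rewrite IH ?fg// => k kn.
by apply: fg; exact: leqW.
Qed.

Lemma digpref_inj M (f g : nat -> nat) n :
  (forall k, (f k < M)%N) -> (forall k, (g k < M)%N) ->
  digpref M f n = digpref M g n -> forall k, (k < n)%N -> f k = g k.
Proof.
move=> fM gM; elim: n => // n IH /= E.
have Efg : f n = g n.
  have := congr1 (modn^~ M) E; rewrite !modnMDl !modn_small//.
move: E; rewrite Efg => /eqP; rewrite eqn_add2r eqn_mul2r => /orP[/eqP M0|/eqP E].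
  by have := fM 0%N; rewrite M0.
by move=> k; rewrite ltnS leq_eqVlt => /orP[/eqP ->//|]; exact: IH.
Qed.

Lemma digval_close (R : realType) M (f g : nat -> nat) n : (1 < M)%N ->
  (forall k, (f k < M)%N) -> (forall k, (g k < M)%N) ->
  (forall k, (k < n)%N -> f k = g k) ->
  `|digval M f - digval M g| <= (M%:R ^+ n)^-1 :> R.
Proof.
move=> M1 fM gM fg.
have /andP[f1 f2] := digval_bounds (R := R) M1 fM n.
have /andP[g1 g2] := digval_bounds (R := R) M1 gM n.
rewrite -(eq_digpref M fg) in g1 g2.
move: f2 g2; rewrite -natr1 mulrDl mul1r => f2 g2.
rewrite ler_norml; apply/andP; split; lra.
Qed.

(* Scaled by M^n, both values are within 1 of their integer prefixes, so that the prefixes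
   differ modulo M^n by less than 2 + 1. *)
Lemma digval_near (R : realType) M (f g : nat -> nat) n (z : int) : (1 < M)%N ->
  (forall k, (f k < M)%N) -> (forall k, (g k < M)%N) ->
  `|digval M f - digval M g - z%:~R| < 2 * (M%:R ^+ n)^-1 :> R ->
  exists v : 'I_5, (digpref M f n + 2 = digpref M g n + v %[mod M ^ n])%N.
Proof.
move=> M1 fM gM.
have Mn0 : 0 < M%:R ^+ n :> R by rewrite exprn_gt0// ltr0n; lia.
have /andP[f1 f2] := digval_bounds (R := R) M1 fM n.
have /andP[g1 g2] := digval_bounds (R := R) M1 gM n.
rewrite !ler_pdivrMr// in f1 g1; rewrite !ler_pdivlMr// in f2 g2.
set p := digpref M f n in f1 f2 *; set q := digpref M g n in g1 g2 *.
move: f1 f2 g1 g2; set P := M%:R ^+ n in Mn0 *; set a := digval M f; set c := digval M g.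
rewrite ltr_pdivlMr// => ap pa cq qc.
have -> : `|a - c - z%:~R| * P = `|(a - c - z%:~R) * P| by rewrite normrM (gtr0_norm Mn0).
rewrite ltr_norml !mulrBl => /andP[H1 H2].
rewrite -!natr1 in pa qc.
have PE : P = (M ^ n)%N%:~R by rewrite /P -natrX.
(* [k] is the difference of the prefixes after removal of a multiple of [M ^ n]. It is an integer
   strictly between -3 and 3, so a shift by 2 brings it into ['I_5]. *)
pose k : int := p%:Z - q%:Z - z * (M ^ n)%N%:Z.
have kE : k%:~R = p%:R - q%:R - z%:~R * P :> R.
  by rewrite /k !rmorphB rmorphM/= PE.
have k1 : -3 < k.
  by rewrite -(ltr_int R) kE; lra.
have k2 : k < 3.
  by rewrite -(ltr_int R) kE; lra.
have k5 : (absz (k + 2)%R < 5)%N by lia.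
exists (Ordinal k5) => /=.
have E : p%:Z + 2 = q%:Z + (absz (k + 2))%:Z + z * (M ^ n)%N%:Z by lia.
(* The congruence is between natural numbers, so the sign of [z] decides on which side the multiple
   of [M ^ n] is added. *)
case: z {H1 H2 kE k1 k2} @k k5 E => z k k5 E.
  have -> : (p + 2 = z * M ^ n + (q + absz (k + 2)%R))%N by nia.
  by rewrite modnMDl.
have <- : (z.+1 * M ^ n + (p + 2) = q + absz (k + 2)%R)%N by nia.
by rewrite modnMDl.
Qed.

Section Expansion.
Context {R : realType} (m : nat -> nat) (r : nat).
Hypothesis m_gt1 : forall j, (j < r)%N -> (1 < m j.+1)%N.

Definition coord (w : nat -> D m r) (j : 'I_r) : nat -> nat := fun k => w k j.

Lemma coord_lt w j k : (coord w j k < m j.+1)%N.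
Proof. exact: ltn_ord. Qed.

Lemma enorm_le_sum (x : 'rV[R]_r) : enorm x <= \sum_j `|x 0 j|.
Proof.
rewrite /enorm -[leRHS]ger0_norm ?sumr_ge0// -sqrtr_sqr ler_wsqrtr//.
rewrite expr2 big_distrlr/=; apply: ler_sum => j _.
rewrite (bigD1 j)//= -normrM -expr2 ger0_norm ?sqr_ge0// lerDl.
by apply: sumr_ge0 => i _; rewrite mulr_ge0.
Qed.

Lemma torus_dist_le (x y : 'rV[R]_r) :
  torus_dist (to_torus x) (to_torus y) <= \sum_j `|x 0 j - y 0 j|.
Proof.
apply: (@le_trans _ _ (enorm (x - y))).
  apply: ge_inf; first by exists 0 => _ [z _ <-]; exact: enorm_ge0.
  by exists (x - y) => //=; rewrite to_torusB.
apply: le_trans (enorm_le_sum _) _.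
by apply: ler_sum => j _; rewrite !mxE.
Qed.

Lemma torus_dist_lt (x y : 'rV[R]_r) c :
  torus_dist (to_torus x) (to_torus y) < c ->
  exists z : 'I_r -> int, forall j, `|x 0 j - y 0 j - (z j)%:~R| < c.
Proof.
move=> dc.
have hinf : has_inf [set enorm u | u in [set u | to_torus u = to_torus x - to_torus y]].
  split; last by exists 0 => _ [u _ <-]; exact: enorm_ge0.
  by exists (enorm (x - y)), (x - y) => //=; rewrite to_torusB.
have [_ [u /= uxy <-] uc] := inf_lt hinf.1 dc.
have /eq_to_torus uZ : to_torus (x - y) = to_torus u by rewrite to_torusB.
have zP j : exists z : int, (x - y) 0 j - u 0 j = z%:~R.
  by have /intrP[z ->] := uZ j; exists z.
exists (fun j => sval (cid (zP j))) => j.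
rewrite -(svalP (cid (zP j))) !mxE (_ : x 0 j - y 0 j - _ = u 0 j); last by ring.
by apply: le_lt_trans uc; exact: ler_coord_enorm.
Qed.

Lemma expansion_close (w w' : nat -> D m r) (n : nat -> nat) :
  (forall k (j : 'I_r), (k < n j)%N -> w k j = w' k j) ->
  mdist (expansion R w) (expansion R w') <= \sum_(j < r) ((m j.+1)%:R ^+ n j)^-1 :> R.
Proof.
move=> ww'; apply: le_trans (torus_dist_le _ _) _.
apply: ler_sum => j _; rewrite !mxE.
apply: (@digval_close R _ (coord w j) (coord w' j)) => //.
- exact: m_gt1.
- by move=> k; exact: coord_lt.
- by move=> k; exact: coord_lt.
- by move=> k kn; rewrite /coord ww'.
Qed.

Lemma expansion_near (w w' : nat -> D m r) (n : nat -> nat) (c : R) :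
  (forall j, (j < r)%N -> c < 2 * ((m j.+1)%:R ^+ n j)^-1) ->
  mdist (expansion R w) (expansion R w') <= c ->
  exists v : {ffun 'I_r -> 'I_5}, forall j : 'I_r,
    (digpref (m j.+1) (coord w j) (n j) + 2 =
     digpref (m j.+1) (coord w' j) (n j) + v j %[mod m j.+1 ^ n j])%N.
Proof.
move=> cn dc.
(* [torus_dist_lt] needs a strict bound, so [e] is placed above [c] and below all the finitely many
   admissible distances; [c + 1] is the default of the minimum. *)
have [e [e_c en]] : exists e, c < e /\ forall j, (j < r)%N -> e <= 2 * ((m j.+1)%:R ^+ n j)^-1.
  exists (\big[Order.min/c + 1]_(j < r) (2 * ((m j.+1)%:R ^+ n j)^-1)); split.
    apply: lt_bigmin => [|j _]; first by rewrite ltrDl.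
    exact: cn.
  by move=> j jr; apply: (bigmin_le _ (Ordinal jr)).
have [z zP] := torus_dist_lt (le_lt_trans dc e_c).
have vP (j : 'I_r) : exists v : 'I_5, (digpref (m j.+1) (coord w j) (n j) + 2 =
     digpref (m j.+1) (coord w' j) (n j) + v %[mod m j.+1 ^ n j])%N.
  apply: (@digval_near R _ _ _ _ (z j)) => //.
  - exact: m_gt1.
  - by move=> k; exact: coord_lt.
  - by move=> k; exact: coord_lt.
  - by apply: lt_le_trans (en j (ltn_ord j)); have := zP j; rewrite !mxE.
exists [ffun j => sval (cid (vP j))] => j.
by rewrite ffunE; exact: (svalP (cid (vP j))).
Qed.

End Expansion.

(** * Hausdorff dimension *)

Section HausdorffLemmas.
Context {R : realType} {T : metricType R}.
Implicit Types (A U : set T) (s : R).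

Lemma le_diam U x y : U x -> U y -> ((mdist x y)%:E <= diam U)%E.
Proof. by move=> Ux Uy; apply: ereal_sup_ubound; exists (x, y). Qed.

Lemma diam_le U (c : R) : (forall x y, U x -> U y -> mdist x y <= c) ->
  (diam U <= c%:E)%E.
Proof.
by move=> Uc; apply: ge_ereal_sup => _ [[x y] [/= Ux Uy] <-]; rewrite lee_fin Uc.
Qed.

Lemma diam_pow_ge0 s U : (0 <= diam_pow s U)%E.
Proof. by rewrite /diam_pow; case: ifP => // _; exact: poweR_ge0. Qed.

Lemma diam_pow_le s U (c : R) : 0 <= s -> 0 <= c -> (diam U <= c%:E)%E ->
  (diam_pow s U <= (c `^ s)%:E)%E.
Proof.
move=> s0 c0 Uc; rewrite /diam_pow; case: ifPn => [_|/set0P[x Ux]].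
  by rewrite lee_fin powR_ge0.
rewrite -poweR_EFin; apply: gt0_ler_poweR => //; rewrite in_itv/= leey andbT.
  by apply: le_trans (le_diam Ux Ux); rewrite lee_fin mdist_ge0.
by rewrite lee_fin.
Qed.

Lemma diam_pow_ge s U (c : R) : 0 <= s -> 0 <= c -> U !=set0 ->
  (c%:E <= diam U)%E -> ((c `^ s)%:E <= diam_pow s U)%E.
Proof.
move=> s0 c0 /set0P U0 Uc; rewrite /diam_pow ifF; last exact/negbTE.
rewrite -poweR_EFin; apply: gt0_ler_poweR => //; rewrite in_itv/= leey andbT ?lee_fin//.
by apply: le_trans Uc; rewrite lee_fin.
Qed.

Lemma premeasure_ge0 s delta A : (0 <= hausdorff_premeasure s delta A)%E.
Proof.
apply: le_ereal_inf_tmp => _ [U _ <-].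
by apply: nneseries_ge0 => k _ _; exact: diam_pow_ge0.
Qed.

(** The finite cover is completed to a sequence by empty sets, which contribute nothing to the
    sum. *)
Lemma hausdorff_measure0 s A :
  (forall delta eta : R, 0 < delta -> 0 < eta ->
    exists (I : finType) (U : I -> set T),
    [/\ A `<=` \bigcup_i U i, forall i, (diam (U i) <= delta%:E)%E
      & (\sum_i diam_pow s (U i) <= eta%:E)%E]) ->
  hausdorff_measure s A = 0%E.
Proof.
move=> cov; apply/eqP; rewrite eq_le; apply/andP; split; last first.
  apply: (@le_trans _ _ (hausdorff_premeasure s 1 A)); first exact: premeasure_ge0.
  by apply: ereal_sup_ubound; exists 1 => /=.
apply: ge_ereal_sup => _ [delta /= delta0 <-].
apply/lee_addgt0Pr => eta eta0; rewrite add0e.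
have [I [U [AU Ud Us]]] := cov _ _ delta0 eta0.
pose V k : set T := if insub k is Some o then U (enum_val (o : 'I_#|I|)) else set0.
have VI (o : 'I_#|I|) : V o = U (enum_val o) by rewrite /V valK.
have V0 k : (#|I| <= k)%N -> V k = set0.
  by move=> Ik; rewrite /V insubF// ltnNge Ik.
apply: (@le_trans _ _ (\sum_(0 <= k <oo) diam_pow s (V k))%E).
  apply: ereal_inf_lbound; exists V => //; split.
    move=> x /AU [i _ Uix]; exists (enum_rank i) => //.
    by rewrite VI enum_rankK.
  move=> k; have [Ik|kI] := leqP #|I| k.
    by rewrite V0//; apply: diam_le => x y [].
  by rewrite -[k]/(val (Ordinal kI)) VI.
rewrite (nneseries_split 0 #|I|)//; last by move=> k _; exact: diam_pow_ge0.
rewrite [X in (_ + X)%E]eseries0 ?adde0; last first.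
  by move=> k /= Ik _; rewrite V0// /diam_pow eqxx.
rewrite big_mkord (eq_bigr (fun o => diam_pow s (U (enum_val o)))).
  by rewrite -(big_enum_val (fun i => diam_pow s (U i)))/=.
by move=> o _; rewrite VI.
Qed.

Lemma hausdorff_dim_ge0 A : (0 <= hausdorff_dim A)%E.
Proof. by apply: le_ereal_inf_tmp => _ [s [s0 _] <-]; rewrite lee_fin. Qed.

Lemma hausdorff_dim_le A (s : R) : 0 <= s ->
  (forall t, s < t -> hausdorff_measure t A = 0%E) ->
  (hausdorff_dim A <= s%:E)%E.
Proof.
move=> s0 mes0; apply/lee_addgt0Pr => e e0; rewrite -EFinD.
apply: ereal_inf_lbound; exists (s + e) => //; split.
  by rewrite addr_ge0// ltW.
by apply: mes0; rewrite ltrDl.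
Qed.

(** The measure is a supremum over mesh sizes, so a positive lower bound at mesh 1 already makes it
    nonzero for every [t < s]. *)
Lemma hausdorff_dim_ge A (s c : R) : 0 < c ->
  (forall t (U : nat -> set T), 0 <= t < s -> A `<=` \bigcup_k U k ->
    (forall k, (diam (U k) <= 1%:E)%E) ->
    (c%:E <= \sum_(0 <= k <oo) diam_pow t (U k))%E) ->
  (s%:E <= hausdorff_dim A)%E.
Proof.
move=> c0 low; apply: le_ereal_inf_tmp => _ [t [t0 At] <-]; rewrite lee_fin leNgt.
apply/negP => ts; suff : (c%:E <= hausdorff_measure t A)%E.
  by rewrite At lee_fin leNgt c0.
apply: (@le_trans _ _ (hausdorff_premeasure t 1 A)); last first.
  by apply: ereal_sup_ubound; exists 1 => /=.
apply: le_ereal_inf_tmp => _ [U [AU U1] <-]; apply: low => //.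
by rewrite t0.
Qed.

End HausdorffLemmas.

(** * Exponents and time scales *)

Section Exponents.
Variables (R : realType) (m : nat -> nat) (r : nat).
Hypothesis m1_ge2 : (2 <= m 1)%N.
Hypothesis m_le : forall i, (1 <= i < r)%N -> (m i <= m i.+1)%N.

Lemma base_gt1 j : (j < r)%N -> (1 < m j.+1)%N.
Proof.
elim: j => [//|j IH] jr; apply: leq_trans (IH (ltnW jr)) _.
by apply: m_le; rewrite jr.
Qed.

Lemma ln_base_gt0 j : (j < r)%N -> 0 < ln (m j.+1)%:R :> R.
Proof. by move=> jr; rewrite ln_gt0// ltr1n base_gt1. Qed.

(** Level 0 is the one-point level of [nsum] and receives the neutral exponent 1; so do the indices
    from [r] on, which keeps every exponent in (0, 1]. *)
Definition expo (j : nat) : R :=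
  if (0 < j < r)%N then log_base (m j.+1)%:R (m j)%:R else 1.

Lemma expo0 : expo 0 = 1. Proof. by []. Qed.

Lemma expo01 j : 0 < expo j <= 1.
Proof.
rewrite /expo; case: ifP => [/andP[j0 jr]|_]; last by rewrite ltr01 lexx.
case: j j0 jr => // j _ jr; rewrite /log_base.
have l1 := ln_base_gt0 (ltnW jr); have l2 := ln_base_gt0 jr.
rewrite divr_gt0//= ler_pdivrMr// mul1r ler_ln ?posrE ?ltr0n ?ler_nat.
- by apply: m_le.
- exact: ltnW (base_gt1 (ltnW jr)).
- exact: ltnW (base_gt1 jr).
Qed.

(** The logarithms telescope: [theta expo j.+1] is the logarithm of [m 1] to the base [m j.+1].
    Prescribing coordinate [j] up to a time proportional to it therefore gives the same side length
    in every direction. *)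
Lemma theta_ln j : (j < r)%N -> theta expo j.+1 * ln (m j.+1)%:R = ln (m 1)%:R.
Proof.
elim: j => [|j IH] jr.
  by rewrite thetaS /theta big_ord0 expo0 !mul1r.
rewrite thetaS -mulrA -(IH (ltnW jr)); congr (_ * _).
rewrite /expo /= jr /log_base divfK// gt_eqF// ln_base_gt0//.
Qed.

Lemma theta_le1 j : theta expo j <= 1.
Proof.
elim: j => [|j IH]; first by rewrite /theta big_ord0.
have /andP[e0 e1] := expo01 j.
by rewrite thetaS mulr_ile1// ltW// theta_gt0// => i; exact: expo01.
Qed.

End Exponents.

(* lam ^+ p j is theta b j * lam ^+ p 0 up to a factor lam ^+ j. *)
Lemma exists_scales (R : realType) (b : nat -> R) (r : nat) (lam : R) : 1 < lam ->
  (forall i, 0 < b i <= 1) ->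
  exists p : nat -> nat, [/\ {homo p : i j /~ (i <= j)%N},
    forall i, (i < r)%N -> lam ^+ p i.+1 <= b i * lam ^+ p i
  & forall j, (j <= r)%N -> theta b j * lam ^+ p 0 <= lam ^+ (p j + j)].
Proof.
move=> lam1 b01.
have lam0 : 0 < lam by exact: lt_trans lam1.
have llam : 0 < ln lam by rewrite ln_gt0.
(* [lam ^- s] approximates [b i] from below within a factor [lam]. *)
have sP i : exists s : nat, 1 <= b i * lam ^+ s <= lam.
  have /andP[b0 b1] := b01 i.
  have x0 : 0 <= - ln (b i) / ln lam.
    by apply: divr_ge0; [rewrite oppr_ge0 ln_le0|exact: ltW].
  have /andP[t1 t2] := truncn_itv x0; set t := Num.truncn _ in t1 t2.
  rewrite ler_pdivlMr// in t1; rewrite ltr_pdivrMr// in t2.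
  exists t.+1; rewrite -[b i * _]lnK ?posrE ?mulr_gt0 ?exprn_gt0//.
  rewrite lnM ?posrE ?exprn_gt0// lnXn//.
  rewrite -mulr_natl; move: t2; rewrite -!natr1 => t2; apply/andP; split.
    by rewrite -[leLHS]expR0 ler_expR; lra.
  by rewrite -[leRHS]lnK ?posrE// ler_expR; lra.
pose s i := sval (cid (sP i)); pose p i := \sum_(i <= k < r) s k.
have pS i : (i < r)%N -> p i = (s i + p i.+1)%N by move=> ir; rewrite /p big_ltn.
have pr i : (r <= i)%N -> p i = 0%N by move=> ri; rewrite /p big_geq.
have sE i : 1 <= b i * lam ^+ s i <= lam by exact: (svalP (cid (sP i))).
exists p; split.
- move=> j i ij; have [jr|rj] := leqP j r; last by rewrite (pr j (ltnW rj)).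
  by rewrite /p (big_cat_nat ij)//= leq_addl.
- move=> i ir; rewrite (pS _ ir) exprD mulrA -[leLHS]mul1r ler_wpM2r ?exprn_ge0 ?(ltW lam0)//.
  by case/andP: (sE i).
- elim=> [|j IH] jr; first by rewrite /theta big_ord0 mul1r addn0.
  rewrite thetaS mulrAC mulrC.
  have /andP[b0 _] := b01 j.
  apply: (le_trans (ler_wpM2l (ltW b0) (IH (ltnW jr)))).
  rewrite (pS _ jr) -addnA exprD mulrA addnS exprS.
  rewrite ler_wpM2r ?exprn_ge0 ?(ltW lam0)//.
  by case/andP: (sE j).
Qed.

(** * The upper bound *)

Definition block (A : Type) (N : nat) (w : nat -> A) (q : nat) : N.-tuple A :=
  [tuple w (q * N + i)%N | i < N].

Lemma expRN_le (R : realType) (x : R) : 0 < x -> expR (- x) <= x^-1.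
Proof.
move=> x0; rewrite expRN lef_pV2 ?posrE ?expR_gt0//.
by apply: le_trans (expR_ge1Dx x); rewrite lerDr.
Qed.

Lemma expr_unbounded (R : realType) (lam X : R) : 1 < lam ->
  exists J : nat, forall j, (J <= j)%N -> X <= lam ^+ j.
Proof.
move=> lam1; have l0 : 0 < ln lam by rewrite ln_gt0.
have lam0 : 0 < lam by exact: lt_trans lam1.
exists (Num.truncn (`|X| / ln lam)).+1 => j Jj.
rewrite -[leRHS]lnK ?posrE ?exprn_gt0// lnXn//.
apply: le_trans (expR_ge1Dx _).
have /andP[_ H] := truncn_itv (divr_ge0 (normr_ge0 X) (ltW l0)).
rewrite ltr_pdivrMr// in H.
have Jj' : (Num.truncn (`|X| / ln lam)).+1%:R <= j%:R :> R by rewrite ler_nat.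
have := ler_wpM2r (ltW l0) Jj'; rewrite -mulr_natl.
have := ler_norm X; lra.
Qed.

Section UpperBound.
Variables (R : realType) (m : nat -> nat) (r : nat) (d0 : D m r).
Hypothesis r_gt0 : (0 < r)%N.
Hypothesis m1_ge2 : (2 <= m 1)%N.
Hypothesis m_le : forall i, (1 <= i < r)%N -> (m i <= m i.+1)%N.

Let b := expo R m r.
Let b01 : forall i, 0 < b i <= 1. Proof. exact: expo01. Qed.

Lemma wsum_ge1 N (P : pred (seq (D m r))) (x : N.-tuple (D m r)) : P x ->
  1 <= wsum d0 b N P.
Proof.
move=> Px; apply: (@nsum_ge1 _ _ b01 _ _ _ _ x) => //; last by rewrite Px.
- exact: tauwE.
- exact: tauw_r.
Qed.

(** [theta_ln] converts the side in direction [j] to the base [m 1], so the exponent no longer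
    depends on [j]; the factor [(m j.+1)%:R ^+ N] pays for truncating the time to an integer. *)
Lemma scale_diam N lam n (t : R) j : (j < r)%N -> 1 < lam ->
  theta b j.+1 * t <= lam ^+ (n + r) ->
  ((m j.+1)%:R ^+ (N * Num.truncn (lam ^+ n)))^-1 <=
  (m j.+1)%:R ^+ N * expR (- (N%:R * ln (m 1)%:R * lam ^- r * t)).
Proof.
move=> jr lam1 tl.
have lam0 : 0 < lam by exact: lt_trans lam1.
have m1 := base_gt1 m1_ge2 m_le jr.
have m0 : 0 < (m j.+1)%:R :> R by rewrite ltr0n ltnW.
have l0 := ln_base_gt0 R m1_ge2 m_le jr.
have /andP[_] := truncn_itv (exprn_ge0 n (ltW lam0)).
set T := Num.truncn _ => nT.
rewrite -[X in X <= _]lnK ?posrE ?invr_gt0 ?exprn_gt0//.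
rewrite -[(m j.+1)%:R ^+ N]lnK ?posrE ?exprn_gt0// -expRD ler_expR.
rewrite lnV ?posrE ?exprn_gt0// !lnXn//.
have <- := theta_ln R m1_ge2 m_le jr; rewrite -/b.
have H : lam ^- r * (theta b j.+1 * t) <= lam ^+ n.
  by rewrite ler_pdivrMl ?exprn_gt0// -exprD addnC.
have N0 : 0 <= N%:R * ln (m j.+1)%:R :> R by rewrite mulr_ge0// ltW.
have := ler_wpM2l N0 (le_trans H (ltW nT)).
rewrite -[ln _ *+ (N * T)]mulr_natl -[ln _ *+ N]mulr_natl natrM -natr1; lra.
Qed.

(** For an exponent [s] above the claimed bound, each window of [K] scales yields a cover by the
    cubes of [good_cubes]. Their number grows more slowly than the [s]-th power of their diameter
    decays, so far windows give arbitrarily small sums. *)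
Lemma hdim_upper N (B : pred (seq (D m r))) (S : set (nat -> D m r)) :
  (0 < N)%N -> S !=set0 -> (forall w, S w -> forall q, B (block N w q)) ->
  (hausdorff_dim (@expansion m R r @` S) <=
    (ln (wsum d0 b N B) / (N%:R * ln (m 1)%:R))%:E)%E.
Proof.
move=> N0 [w0 Sw0] SB.
set Z := wsum d0 b N B.
have Z1 : 1 <= Z by apply: wsum_ge1; exact: (SB _ Sw0 0%N).
have lZ : 0 <= ln Z by rewrite ln_ge0.
have lm1 : 0 < ln (m 1)%:R :> R by exact: (ln_base_gt0 R m1_ge2 m_le r_gt0).
have Nm : 0 < N%:R * ln (m 1)%:R :> R by rewrite mulr_gt0// ltr0n.
apply: hausdorff_dim_le => [|s].
  by rewrite divr_ge0// ltW.
rewrite ltr_pdivrMr//; set A := s * _ => ZA.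
have s0 : 0 < s by rewrite -(pmulr_lgt0 s Nm); apply: le_lt_trans ZA.
(* Strictly between [ln Z] and [A]: the lower gap pays for [e], the upper gap for the rounding of
   scales to powers of [lam]. *)
pose A' := (A + ln Z) / 2.
have A'A : A' < A by rewrite /A'; lra.
have ZA' : ln Z < A' by rewrite /A'; lra.
have A'0 : 0 < A' by exact: le_lt_trans ZA'.
clearbody A'.
have A0 : 0 < A by exact: lt_trans A'A.
(* Chosen so that [lam ^+ r] stays below [A / A']. *)
pose c := ln (A / A') / r.+1%:R.
have lAA : 0 < ln (A / A') by rewrite ln_gt0// ltr_pdivlMr// mul1r.
have c0 : 0 < c by rewrite divr_gt0.
pose lam := expR c.
have lam1 : 1 < lam by rewrite /lam -expR0 ltr_expR.
have lam0 : 0 < lam by exact: lt_trans lam1.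
have lamr : A' * lam ^+ r < A.
  rewrite mulrC -ltr_pdivlMr// /lam -expRM_natl -[ltRHS]lnK ?posrE ?divr_gt0//.
  rewrite ltr_expR /c mulrC -mulrA gtr_pMr// mulrC ltr_pdivrMr// mul1r ltr_nat.
  exact: ltnSn.
pose beta := A * lam ^- r - A'.
have beta0 : 0 < beta by rewrite /beta subr_gt0 ltr_pdivlMr ?exprn_gt0.
have [p [p_homo p_lam p_theta]] := exists_scales r lam1 b01.
pose T n := Num.truncn (lam ^+ n).
have T_le n : (T n)%:R <= lam ^+ n.
  by have /andP[Tn _] := truncn_itv (exprn_ge0 n (ltW lam0)); exact: Tn.
have T_homo : {homo T : i j / (i <= j)%N}.
  move=> i j ij; rewrite /T; apply: le_truncn.
  by rewrite ler_eXn2l.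
(* With this [e] the number of cubes at scale [j] is at most [expR (A' * lam ^+ (j + p 0))]. *)
pose e := (A' - ln Z) * lam ^+ p 0.
have e0 : 0 < e by rewrite mulr_gt0 ?subr_gt0 ?exprn_gt0.
have [|K [cubes [cubes_card cubesP]]] := @good_cubes _ _ b01 _ _ _ (@tauwE _ _ d0 N)
  (@tauw0 _ _ d0 N) (@tauw_r _ _ d0 N) (fun x => B x) lam p T lam1 p_homo p_lam T_homo T_le e e0.
  by exists (block N w0 0); exact: SB.
apply: hausdorff_measure0 => delta eta delta0 eta0.
pose rate := N%:R * ln (m 1)%:R * lam ^- r.
have rate0 : 0 < rate by rewrite mulr_gt0// invr_gt0 exprn_gt0.
pose C : R := \sum_(j < r) (m j.+1)%:R ^+ N.
have C0 : 0 <= C by apply: sumr_ge0 => j _; rewrite exprn_ge0.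
pose rho J := C * expR (- (rate * (lam ^+ (J + p 0)))).
have rho0 J : 0 <= rho J by rewrite mulr_ge0 ?expR_ge0.
pose Q J (c : {ffun 'I_(T (J + p 1)) -> N.-tuple (D m r)}) : set (torus R r) :=
  @expansion m R r @` [set w | S w /\ c = [ffun k : 'I_(T (J + p 1)) =>
    tauw d0 (depth r (fun i => T (J + p i)) k) (block N w k)]].
have Q_diam J z : (diam (Q J z) <= (rho J)%:E)%E.
  apply: diam_le => _ _ [w [_ zw] <-] [w' [_ zw'] <-].
  apply: le_trans (expansion_close (base_gt1 m1_ge2 m_le)
    (n := fun j => (N * T (J + p j.+1))%N) _) _.
    move=> k j kj.
    have qT : (k %/ N < T (J + p j.+1))%N by rewrite ltn_divLR// mulnC.
    have L_homo : {homo (fun i => T (J + p i)) : i i' /~ (i <= i')%N}.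
      by move=> i i' ii'; apply: T_homo; rewrite leq_add2l; exact: p_homo.
    have q1 : (k %/ N < T (J + p 1))%N by apply: leq_trans qT _; apply: L_homo.
    have := congr1 (fun f : {ffun 'I_(T (J + p 1)) -> N.-tuple (D m r)} =>
      f (Ordinal q1)) (etrans (esym zw) zw').
    rewrite !ffunE/= => /tauw_eqP H.
    have kN : (k %% N < N)%N by rewrite ltn_mod.
    have := H (Ordinal kN) j; rewrite ltn_depth// => /(_ qT).
    by rewrite !tnth_mktuple /= -divn_eq.
  rewrite /rho /C mulr_suml; apply: ler_sum => j _.
  apply: scale_diam => //.
  rewrite (_ : theta b j.+1 * _ = lam ^+ J * (theta b j.+1 * lam ^+ p 0)); last first.
    by rewrite exprD mulrCA.
  apply: (@le_trans _ _ (lam ^+ J * lam ^+ (p j.+1 + j.+1))).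
    by rewrite ler_wpM2l ?exprn_ge0 ?(ltW lam0)// p_theta.
  by rewrite -exprD ler_eXn2l// addnA leq_add2l.
(* The first summand forces the diameters below [delta]; the second makes each of the [K] scales
   contribute at most [eta / K]. *)
have [J JP] := @expr_unbounded R lam
  (C / (delta * rate) + K%:R * C `^ s / (eta * beta)) lam1.
pose I : finType := {j : 'I_K & {ffun 'I_(T (J + j + p 1)) -> N.-tuple (D m r)}}.
pose U (j : 'I_K) c := if c \in cubes (J + j)%N then Q (J + j)%N c else set0.
have lamJ j' : lam ^+ J <= lam ^+ (J + j' + p 0).
  by rewrite ler_eXn2l// -addnA leq_addr.
have X1 : 0 <= C / (delta * rate) by rewrite divr_ge0// mulr_ge0// ltW.
have X2 : 0 <= K%:R * C `^ s / (eta * beta).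
  by rewrite divr_ge0 ?mulr_ge0 ?powR_ge0// ltW.
have JX := JP J (leqnn J).
exists I, (fun i : I => U (tag i) (tagged i)); split.
- move=> _ [w Sw <-].
  have [j jJ cj] := cubesP (block N w) (SB w Sw) J.
  have /andP[Jj jJK] := jJ.
  have jK : (j - J < K)%N by rewrite ltn_subLR.
  have jE : j = (J + Ordinal jK)%N by rewrite /= subnKC.
  rewrite jE in cj.
  exists (Tagged (fun j : 'I_K => {ffun 'I_(T (J + j + p 1)) -> N.-tuple (D m r)})
    [ffun k : 'I_(T (J + Ordinal jK + p 1)) =>
    tauw d0 (depth r (fun i => T (J + Ordinal jK + p i)) k) (block N w k)]) => //.
  rewrite /U /= cj; exists w => //.
- move=> [j z]; rewrite /U/=; case: ifP => _; last first.
    by apply: diam_le => x y [].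
  apply: le_trans (Q_diam _ _) _; rewrite lee_fin /rho.
  set t := lam ^+ _; have t0 : 0 < t by rewrite exprn_gt0.
  apply: (@le_trans _ _ (C * (rate * t)^-1)).
    by apply: ler_wpM2l => //; apply: expRN_le; rewrite mulr_gt0.
  have rt0 : 0 < rate * t by exact: mulr_gt0.
  have dr0 : 0 < delta * rate by exact: mulr_gt0.
  rewrite ler_pdivrMr// (mulrA delta) [leRHS]mulrC -ler_pdivrMr//.
  apply: le_trans (lamJ j); apply: le_trans JX; rewrite lerDl//.
- rewrite -(@sig_big_dep _ _ _ _ _ xpredT (fun _ => xpredT) (fun j z => diam_pow s (U j z)))/=.
  apply: (@le_trans _ _ (\sum_(j < K) (eta / K%:R)%:E)%E); last first.
    rewrite sumEFin lee_fin sumr_const card_ord.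
    have [->|K0] := posnP K; first by rewrite mulr0n ltW.
    by rewrite -[(eta / _) *+ _]mulr_natr divfK// pnatr_eq0 -lt0n.
  apply: lee_sum => j _.
  have K0 : (0 < K)%N by apply: leq_ltn_trans (ltn_ord j).
  apply: (@le_trans _ _ (\sum_(z in cubes (J + j)%N) (rho (J + j)%N `^ s)%:E)%E).
    rewrite [leRHS]big_mkcond; apply: lee_sum => z _; rewrite /U; case: ifP => _.
      by apply: diam_pow_le => //; exact: ltW.
    by rewrite /diam_pow eqxx.
  rewrite sumEFin lee_fin sumr_const -[(_ `^ s) *+ _]mulr_natl.
  set t := lam ^+ (J + j + p 0); have t0 : 0 < t by rewrite exprn_gt0.
  apply: (@le_trans _ _ (expR (A' * t) * (C `^ s * expR (- (A * lam ^- r * t))))).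
    apply: ler_pM => //; first exact: powR_ge0.
      apply: le_trans (cubes_card _) _; rewrite ler_expR.
      have := ler_wpM2r lZ (T_le (J + j + p 0)%N).
      by rewrite /e /t [lam ^+ (J + j + p 0)]exprD; lra.
    rewrite /rho powRM ?expR_ge0// ler_wpM2l ?powR_ge0// -expRM ler_expR.
    by rewrite -/t /A /rate; lra.
  rewrite mulrCA -expRD (_ : A' * t - _ = - (beta * t)); last by rewrite /beta; ring.
  apply: (@le_trans _ _ (C `^ s * (beta * t)^-1)).
    by apply: ler_wpM2l; [exact: powR_ge0|apply: expRN_le; rewrite mulr_gt0].
  have eb0 : 0 < eta * beta by exact: mulr_gt0.
  have bt0 : 0 < beta * t by exact: mulr_gt0.
  have : K%:R * C `^ s <= t * (eta * beta).
    rewrite -ler_pdivrMr//.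
    by apply: le_trans (lamJ j); apply: le_trans JX; rewrite lerDr.
  move=> H; rewrite ler_pdivrMr// [leRHS]mulrAC ler_pdivlMr ?ltr0n//; lra.
Qed.

End UpperBound.

(** * The lower bound *)

(** A successor length keeps the division meaningful and the index type inhabited, as [inord]
    requires. *)
Definition unblock (A : Type) (N : nat) (x : nat -> N.+1.-tuple A) (n : nat) : A :=
  tnth (x (n %/ N.+1)%N) (inord (n %% N.+1)%N).

Lemma unblockE (A : Type) N (x : nat -> N.+1.-tuple A) q (i : 'I_N.+1) :
  unblock x (q * N.+1 + i)%N = tnth (x q) i.
Proof.
by rewrite /unblock divnMDl// divn_small// addn0 modnMDl modn_small// inord_val.
Qed.

Lemma block_unblock (A : Type) N (x : nat -> N.+1.-tuple A) q :
  block N.+1 (unblock x) q = x q.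
Proof. by apply/eq_from_tnth => i; rewrite tnth_mktuple unblockE. Qed.

Lemma sum_half (R : realType) n : \sum_(k < n) (2 ^- k.+2 : R) <= 2^-1.
Proof.
suff -> : \sum_(k < n) (2 ^- k.+2 : R) = 2^-1 - 2 ^- n.+1.
  by rewrite lerBlDr lerDl invr_ge0 exprn_ge0.
elim: n => [|n IH]; first by rewrite big_ord0 expr1 subrr.
rewrite big_ord_recr/= IH !exprS; field; exact: expf_neq0.
Qed.

Lemma theta_homo (R : realType) (b : nat -> R) : (forall i, 0 < b i <= 1) ->
  forall i j, (i <= j)%N -> theta b j <= theta b i.
Proof.
move=> b01 i j /subnK <-; elim: (j - i)%N => //= n IH.
rewrite addSn thetaS; apply: le_trans IH; rewrite ger_pMr ?theta_gt0//.
by case/andP: (b01 (n + i)%N).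
Qed.

Section ScaleOfSet.
Context {R : realType} {T : metricType R}.

(* n is as large as the diameter of U permits; zeta absorbs the sets of diameter 0. *)
Lemma set_scale (U : set T) (a s t zeta : R) : 0 < a -> 0 <= t < s -> 0 < zeta ->
  (diam U <= 1%:E)%E ->
  exists (n : nat) (d : R), [/\ 0 <= d, (d%:E <= diam_pow t U)%E,
    forall x y, U x -> U y -> mdist x y <= expR (- (a * n%:R))
  & expR (- (s * a * n%:R)) <= expR (s * a) * (d + zeta)].
Proof.
move=> a0 /andP[t0 ts] z0 U1; have s0 : 0 < s by exact: le_lt_trans ts.
have [u [u0 u1 udiam upow]] : exists u : R, [/\ 0 <= u, u <= 1,
    forall x y, U x -> U y -> mdist x y <= u & ((u `^ s)%:E <= diam_pow t U)%E].
  have [->|U0] := eqVneq U set0.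
    exists 0; split => //; rewrite powR0 ?gt_eqF//; exact: diam_pow_ge0.
  have /set0P[x Ux] := U0.
  have dU0 : (0%:E <= diam U)%E.
    by apply: le_trans (le_diam Ux Ux); rewrite lee_fin mdist_ge0.
  have dfin : diam U \is a fin_num.
    by rewrite ge0_fin_numE// (le_lt_trans U1)// ltry.
  have f0 : 0 <= fine (diam U) by exact: fine_ge0.
  have f1 : fine (diam U) <= 1 by rewrite -lee_fin fineK.
  exists (fine (diam U)); split=> //.
    by move=> y z Uy Uz; rewrite -lee_fin fineK// le_diam.
  apply: (@le_trans _ _ (fine (diam U) `^ t)%:E).
    rewrite lee_fin; have [->|fn0] := eqVneq (fine (diam U)) 0.
      by rewrite powR0 ?gt_eqF// powR_ge0.
    have fp : 0 < fine (diam U) by rewrite lt_def fn0.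
    by rewrite /powR (negbTE fn0) ler_expR ler_wnM2r ?ln_le0// ltW.
  by apply: diam_pow_ge => //; [exact/set0P|rewrite fineK].
(* The [s]-th power of [eta] is at most [zeta]. The larger of [u] and [eta] is positive and thus has
   a meaningful logarithm even when [u] is 0. *)
pose eta := Order.min 1 (zeta `^ s^-1).
have eta0 : 0 < eta by rewrite lt_min ltr01 powR_gt0.
have eta_s : eta `^ s <= zeta.
  apply: (@le_trans _ _ ((zeta `^ s^-1) `^ s)).
    by apply: powR_homo; [exact: ltW|exact: ltW|rewrite ge_min lexx orbT].
  by rewrite -powRrM mulVf ?gt_eqF// powRr1// ltW.
pose v := Order.max u eta.
have v0 : 0 < v by rewrite lt_max eta0 orbT.
have v1 : v <= 1 by rewrite ge_max u1 ge_min lexx.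
have vs : v `^ s <= u `^ s + zeta.
  rewrite /v; case: (leP u eta) => _.
    by apply: le_trans eta_s _; rewrite lerDr powR_ge0.
  by rewrite lerDl ltW.
have x0 : 0 <= - ln v / a by rewrite divr_ge0 ?(ltW a0)// oppr_ge0 ln_le0.
have /andP[n1 n2] := truncn_itv x0; set n := Num.truncn _ in n1 n2.
rewrite ler_pdivlMr// in n1; rewrite ltr_pdivrMr// in n2.
exists n, (u `^ s); split=> //; first exact: powR_ge0.
  move=> x y Ux Uy; apply: (le_trans (udiam _ _ Ux Uy)).
  apply: (@le_trans _ _ v); first by rewrite le_max lexx.
  rewrite -[leLHS]lnK ?posrE// ler_expR mulrC; lra.
apply: (@le_trans _ _ (expR (s * a) * v `^ s)); last first.
  by rewrite ler_wpM2l ?expR_ge0.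
rewrite /powR gt_eqF// -expRD ler_expR.
rewrite -natr1 in n2.
by have := ler_wpM2l (ltW s0) (ltW n2); lra.
Qed.

End ScaleOfSet.

Section LowerBound.
Variables (R : realType) (m : nat -> nat) (r : nat) (d0 : D m r).
Hypothesis r_gt0 : (0 < r)%N.
Hypothesis m1_ge2 : (2 <= m 1)%N.
Hypothesis m_le : forall i, (1 <= i < r)%N -> (m i <= m i.+1)%N.

Let b := expo R m r.
Let b01 : forall i, 0 < b i <= 1. Proof. exact: expo01. Qed.

(** Two prefixes congruent to the same number modulo a power that exceeds both are equal, and equal
    prefixes have equal digits. *)
Lemma eq_cylinder M (x x' : nat -> M.+1.-tuple (D m r)) (L : nat -> nat)
    (w : nat -> D m r) (v : {ffun 'I_r -> 'I_5}) :
  {homo L : i j /~ (i <= j)%N} ->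
  (forall y, y = x \/ y = x' -> forall j : 'I_r,
    (digpref (m j.+1) (coord (unblock y) j) (M.+1 * L j.+1) + 2 =
     digpref (m j.+1) (coord w j) (M.+1 * L j.+1) + v j
       %[mod m j.+1 ^ (M.+1 * L j.+1)])%N) ->
  forall i, tauw d0 (depth r L i) (x i) = tauw d0 (depth r L i) (x' i).
Proof.
move=> L_homo xv i; apply/tauw_eqP => k j jd.
have m1 := base_gt1 m1_ge2 m_le (ltn_ord j).
have iL : (i < L j.+1)%N by rewrite -(ltn_depth _ L_homo (ltn_ord j)).
have := etrans (xv x (or_introl erefl) j) (esym (xv x' (or_intror erefl) j)).
move=> /eqP; rewrite eqn_modDr !modn_small; try by apply: digpref_lt => // n; exact: coord_lt.
move=> /eqP/digpref_inj H.
have := H (coord_lt _ _) (coord_lt _ _) (i * M.+1 + k)%N.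
rewrite /coord !unblockE => /(_ _)/val_inj; apply.
have := ltn_ord k; rewrite -ltnS; nia.
Qed.

(** By [theta_ln] both sides have the same rate in every direction, and truncation only enlarges the
    right-hand side; the factor 2 makes the inequality strict. *)
Lemma rate_lt M n (j : 'I_r) :
  expR (- (M%:R * ln (m 1)%:R * n%:R)) <
  2 * ((m j.+1)%:R ^+ (M * Num.truncn (n%:R * theta b j.+1)))^-1 :> R.
Proof.
have mj : 0 < (m j.+1)%:R :> R by rewrite ltr0n ltnW// (base_gt1 m1_ge2 m_le).
have lj := ln_base_gt0 R m1_ge2 m_le (ltn_ord j).
have th := theta_gt0 b01 j.+1.
have /andP[T1 _] := truncn_itv (mulr_ge0 (ler0n R n) (ltW th)).
set T := Num.truncn _ in T1 *.
have p0 : 0 < ((m j.+1)%:R ^+ (M * T))^-1 :> R by rewrite invr_gt0 exprn_gt0.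
apply: (@le_lt_trans _ _ ((m j.+1)%:R ^+ (M * T))^-1); last by rewrite ltr_pMl// ltr1n.
rewrite -[leRHS]lnK ?posrE// ler_expR lnV ?posrE ?exprn_gt0// lerN2 lnXn//.
have <- := theta_ln R m1_ge2 m_le (ltn_ord j); rewrite -/b.
have Ml : 0 <= M%:R * ln (m j.+1)%:R :> R by rewrite mulr_ge0// ltW.
have := ler_wpM2l Ml T1; rewrite -[ln _ *+ _]mulr_natl natrM; lra.
Qed.

(** After homogenisation, [wsum] is at most [(2 * K)%:R ^+ r * expR L], so it remains to bound the
    dimension from below by [L / a]. A covering set meets at most [5 ^ r] cylinders of its own
    scale, so the mass distribution principle on sequences of blocks from [H] bounds the Hausdorff
    sums from below. *)
Lemma hdim_lower M (B : pred (seq (D m r))) (S : set (nat -> D m r)) (h : R) :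
  (forall w, (forall q, B (block M.+1 w q)) -> S w) -> 0 <= h ->
  (hausdorff_dim (@expansion m R r @` S) <= h%:E)%E ->
  wsum d0 b M.+1 B <= (2 * (trunc_log 2 #|{: M.+1.-tuple (D m r)}|).+1)%:R ^+ r *
    expR (M.+1%:R * ln (m 1)%:R * h).
Proof.
move=> BS h0 dimh.
have [w0|wn0] := eqVneq (wsum d0 b M.+1 B) 0.
  by rewrite w0 mulr_ge0 ?exprn_ge0 ?expR_ge0.
have w_gt0 : 0 < wsum d0 b M.+1 B by rewrite lt_def wn0 wsum_ge0.
have tE := @tauwE _ _ d0 M.+1; have t0 := @tauw0 _ _ d0 M.+1.
have tr := @tauw_r _ _ d0 M.+1.
have [H [N [HB [y0 _ Hy0] N0 Hbr wN]]] := homogenize b01 tE t0 w_gt0.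
set K := (trunc_log 2 _).+1 in wN *.
pose L : R := \sum_(j < r) theta b j.+1 * ln (N j)%:R.
have lnN j : 0 <= ln (N j)%:R :> R by rewrite ln_ge0// ler1n.
have L0 : 0 <= L by apply: sumr_ge0 => j _; rewrite mulr_ge0// ltW// theta_gt0.
have {}wN : wsum d0 b M.+1 B <= (2 * K)%:R ^+ r * expR L.
  apply: (le_trans wN); rewrite /L expR_sum -[X in _ ^+ X]card_ord -prodr_const -big_split/=.
  apply: ler_prod => j _; rewrite mulr_ge0 ?powR_ge0//=.
  rewrite [(2 * N j)%:R]natrM powRM// mulrA [(2 * K)%:R]natrM.
  apply: ler_pM => //; rewrite ?mulr_ge0 ?powR_ge0//.
    rewrite mulrC; apply: ler_wpM2r => //; rewrite -[leRHS]powRr1//.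
    by rewrite ler_powR ?ler1n// theta_le1.
  by rewrite /powR pnatr_eq0 -leqn0 leqNgt N0.
have l1 : 0 < ln (m 1)%:R :> R by exact: (ln_base_gt0 R m1_ge2 m_le r_gt0).
pose a := M.+1%:R * ln (m 1)%:R : R.
have a0 : 0 < a by rewrite mulr_gt0.
pose s := L / a.
have sa : s * a = L by rewrite divfK// gt_eqF.
apply: (le_trans wN); rewrite ler_wpM2l ?exprn_ge0// ler_expR -sa mulrC -/a.
rewrite ler_wpM2l ?(ltW a0)// -lee_fin; apply: le_trans dimh.
(* The factors pay for the [5 ^ r] offsets, for truncating the times [Lk], and for the loss
   [expR (s * a)] in [set_scale]. *)
pose C1 : R := (5 ^ r)%:R * (\prod_(j < r) (N j)%:R) * expR L.
have C1_gt0 : 0 < C1.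
  rewrite mulr_gt0 ?expR_gt0// mulr_gt0 ?ltr0n ?expn_gt0//.
  by apply: prodr_gt0 => j _; rewrite ltr0n.
apply: (@hausdorff_dim_ge _ _ _ _ (2 * C1)^-1) => [|t U ts covU U1].
  by rewrite invr_gt0 mulr_gt0.
(* The sum of the [C1 * zeta k] is at most 1/2, which leaves half of the mass to the terms
   [dk k]. *)
pose zeta k : R := 2 ^- k.+2 / C1.
have zeta0 k : 0 < zeta k by rewrite divr_gt0// invr_gt0 exprn_gt0.
have /choice[tk tkP] k := set_scale a0 ts (zeta0 k) (U1 k).
have /choice[dk dkP] := tkP.
pose Lk k i := Num.truncn ((tk k)%:R * theta b i).
have Lk_homo k : {homo Lk k : i j /~ (i <= j)%N}.
  by move=> i j ij; apply: le_truncn; rewrite ler_wpM2l// theta_homo.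
pose inH (x : nat -> M.+1.-tuple (D m r)) := forall i, H (x i).
pose inU k x := inH x /\ U k (@expansion m R r (unblock x)).
pose cg k (x y : nat -> M.+1.-tuple (D m r)) (v : {ffun 'I_r -> 'I_5}) := forall j : 'I_r,
  (digpref (m j.+1) (coord (unblock x) j) (M.+1 * Lk k j.+1) + 2 =
   digpref (m j.+1) (coord (unblock y) j) (M.+1 * Lk k j.+1) + v j
     %[mod m j.+1 ^ (M.+1 * Lk k j.+1)])%N.
(* One reference sequence per covering set: every other sequence in the set is related to it by an
   offset [v]. *)
have yP k : exists y, forall x, inU k x -> exists v, cg k x y v.
  have [[y [_ Uy]]|nex] := pselect (exists y, inU k y); last first.
    by exists (fun=> y0) => x Ux; exfalso; apply: nex; exists x.
  exists y => x [_ Ux]; have [_ _ Ud _] := dkP k.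
  apply: (expansion_near (base_gt1 m1_ge2 m_le)
    (n := fun j => (M.+1 * Lk k j.+1)%N) _ (Ud _ _ Ux Uy)) => j jr.
  exact: (rate_lt M.+1 (tk k) (Ordinal jr)).
have [y {}yP] := choice yP.
(* Each offset class that occurs gets a representative, around which its cylinder is taken. *)
have zP k : exists z : {ffun 'I_r -> 'I_5} -> nat -> M.+1.-tuple (D m r),
    forall v x, cg k x (y k) v -> cg k (z v) (y k) v.
  have zvP v : exists zv, forall x, cg k x (y k) v -> cg k zv (y k) v.
    have [[x xP]|nex] := pselect (exists x, cg k x (y k) v); first by exists x.
    by exists (fun=> y0) => x xP; exfalso; apply: nex; exists x.
  by have [zk zkP] := choice zvP; exists zk.
have [z {}zP] := choice zP.
have [|||n nP] := @mass_distribution R _ _ _ tE t0 tr H N _ N0 _ _ Lk z Lk_homo.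
- by exists y0.
- by move=> j x jr Hx; apply: Hbr => //; exact: tr.
- move=> x Hx.
  have [k _ Uk] : (\bigcup_k U k) (@expansion m R r (unblock x)).
    apply: covU; exists (unblock x) => //; apply: BS => q.
    by rewrite block_unblock; exact: HB.
  have [v xv] := yP k x (conj Hx Uk).
  exists k, v; apply: (@eq_cylinder M x (z k v) (Lk k) (unblock (y k)) v) => // x' [->|->]//.
  exact: zP xv.
have term k : \prod_(j < r) ((N j)%:R^-1 : R) ^+ Lk k j.+1 <=
    (\prod_(j < r) (N j)%:R) * expR (- (s * a * (tk k)%:R)).
  rewrite sa /L mulr_suml -sumrN expR_sum -big_split/=; apply: ler_prod => j _.
  rewrite exprn_ge0 ?invr_ge0//=.
  have Nj : 0 < (N j)%:R :> R by rewrite ltr0n.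
  have th := theta_gt0 b01 j.+1.
  have /andP[_ T2] := truncn_itv (mulr_ge0 (ler0n R (tk k)) (ltW th)).
  rewrite -/(Lk k j.+1) -natr1 in T2.
  rewrite -[leLHS]lnK ?posrE ?exprn_gt0 ?invr_gt0// -{2}[(N j)%:R]lnK ?posrE//.
  rewrite -expRD ler_expR lnXn ?invr_gt0// lnV ?posrE// -[(- _) *+ _]mulr_natl.
  by have := ler_wpM2r (lnN j) (ltW T2); lra.
have bound : 1 <= C1 * \sum_(k < n) dk k + 2^-1.
  apply: (le_trans nP); apply: (@le_trans _ _ (\sum_(k < n) C1 * (dk k + zeta k))).
    apply: ler_sum => k _; rewrite sumr_const card_ffun !card_ord.
    rewrite -[(\prod_(_ < _) _) *+ _]mulr_natl.
    rewrite /C1 -mulrA -mulrA; apply: ler_wpM2l => //; apply: le_trans (term k) _.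
    apply: ler_wpM2l; first exact: prodr_ge0.
    by rewrite -sa; have [_ _ _] := dkP k.
  rewrite -mulr_sumr big_split/= mulrDr lerD2l mulr_sumr.
  apply: le_trans (sum_half R n); apply: ler_sum => k _.
  by rewrite /zeta mulrC divfK// gt_eqF.
have dsum : (2 * C1)^-1 <= \sum_(k < n) dk k.
  have C2 : 0 < 2 * C1 by apply: mulr_gt0.
  by rewrite -[leLHS]mul1r ler_pdivrMr//; lra.
apply: (@le_trans _ _ (\sum_(0 <= k < n) diam_pow t (U k))%E); last first.
  by apply: nneseries_lim_ge => k _ _; exact: diam_pow_ge0.
apply: (@le_trans _ _ (\sum_(k < n) dk k)%:E); first by rewrite lee_fin.
by rewrite -sumEFin big_mkord; apply: lee_sum => k _; have [_ ? _ _] := dkP k.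
Qed.

End LowerBound.

(** * Paths in the graph *)

Section GraphPaths.
Context {L : finType} (G : labelled_graph L).
Notation V := 'I_(nvert G).
Implicit Types (u v w : V) (x : seq L) (A : {set V}).

Fixpoint epath v (es : seq (edge G)) w : bool :=
  if es is e :: es' then (source e == v) && epath (target e) es' w else v == w.

Fixpoint runb v x w : bool :=
  if x is d :: x' then
    [exists e : edge G, [&& source e == v, label e == d & runb (target e) x' w]]
  else v == w.

Fixpoint pathb A v x : bool :=
  (v \in A) && if x is d :: x' then
    [exists e : edge G, [&& source e == v, label e == d & pathb A (target e) x']]
  else true.

Lemma pathb_in A v x : pathb A v x -> v \in A.
Proof. by case: x => [|d x] /andP[]. Qed.

Lemma runbP v x w : runb v x w -> exists2 es, map (@label _ G) es = x & epath v es w.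
Proof.
elim: x v => [|d x IH] v /=; first by move=> vw; exists [::].
move=> /existsP[e /and3P[ev ed /IH[es <- eps]]].
by exists (e :: es); rewrite /= ?ev ?(eqP ed).
Qed.

Lemma epath_chain e0 v es w : epath v es w -> (0 < size es)%N ->
  [/\ source (nth e0 es 0) = v, target (nth e0 es (size es).-1) = w &
     forall i, (i.+1 < size es)%N -> target (nth e0 es i) = source (nth e0 es i.+1)].
Proof.
elim: es v => // e [|e' es] IH v /=.
  by move=> /andP[/eqP <- /eqP <-] _; split.
move=> /andP[/eqP ev /= ee'] _.
have /(_ isT)[s0 sl si] := IH (target e) ee'.
by split=> // -[|i] ile //=; rewrite -?s0//; exact: si.
Qed.

(* Cut at the last visit to v. *)
Lemma pathb_split A v u x : pathb A u x -> pathb (A :\ v) u x \/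
  exists l, [/\ (l <= size x)%N, runb u (take l x) v
    & l = size x \/ (l < size x)%N /\ exists v', pathb (A :\ v) v' (drop l.+1 x)].
Proof.
elim: x u => [|d x IH] u /=.
  rewrite andbT => uA; have [->|uv] := eqVneq u v.
    by right; exists 0%N; split; rewrite /= ?eqxx//; left.
  by left; rewrite !inE uv uA.
move=> /andP[uA /existsP[e /and3P[eu ed ex]]].
have [ev|[l [lx rl lrest]]] := IH _ ex.
  have [uv|uv] := eqVneq u v.
    right; exists 0%N; split => //=; first exact/eqP.
    by right; split=> //; exists (target e); rewrite drop0.
  by left; rewrite !inE uv uA/=; apply/existsP; exists e; rewrite eu ed.
right; exists l.+1; split => //=.
  by apply/existsP; exists e; rewrite eu ed.
by case: lrest => [->|[lx' ?]]; [left|right].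
Qed.

Lemma sofic_block (N : nat) (s : nat -> L) (q : nat) : sofic G s ->
  exists v, pathb [set: V]%SET v [seq s (q * N + i)%N | i <- iota 0 N].
Proof.
move=> [p [pchain plab]].
suff H n k : pathb [set: V]%SET (source (p k)) [seq s (k + i)%N | i <- iota 0 n].
  by exists (source (p (q * N)%N)).
elim: n k => [|n IH] k /=; first by rewrite inE.
rewrite inE/=; apply/existsP; exists (p k); rewrite eqxx addn0 plab eqxx/=.
have := IH k.+1; rewrite pchain (iotaDl 1 0) -map_comp.
by congr (pathb _ _ _); apply: eq_map => i; rewrite /= addnS.
Qed.

(** The loops at [u], one per block, are concatenated: step [k] uses edge [k %% M.+1] of loop
    [k %/ M.+1]. *)
Lemma sofic_loops (M : nat) u (s : nat -> L) :
  (forall q, runb u [seq s (q * M.+1 + i)%N | i <- iota 0 M.+1] u) -> sofic G s.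
Proof.
move=> loops.
have /choice[es esP] q : exists es, map (@label _ G) es =
    [seq s (q * M.+1 + i)%N | i <- iota 0 M.+1] /\ epath u es u.
  by have [es ? ?] := runbP (loops q); exists es.
have sz q : size (es q) = M.+1.
  by rewrite -(size_map (@label _ G)) (esP q).1 size_map size_iota.
have [e0 _] : exists e0 : edge G, True.
  by case: (es 0%N) (sz 0%N) => // e ? _; exists e.
have sz0 q : (0 < size (es q))%N by rewrite sz.
have ch q := epath_chain e0 (esP q).2 (sz0 q).
exists (fun k => nth e0 (es (k %/ M.+1)%N) (k %% M.+1)%N); split=> k; last first.
  have kM : (k %% M.+1 < M.+1)%N by rewrite ltn_mod.
  rewrite -(nth_map e0 (s 0%N)) ?sz// (esP _).1 (nth_map 0%N) ?size_iota//.
  by rewrite nth_iota// add0n -divn_eq.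
have [s0 tl st] := ch (k %/ M.+1)%N; rewrite sz in tl st.
have kM : (k %% M.+1 < M.+1)%N by rewrite ltn_mod.
rewrite {3 4}(divn_eq k M.+1) -addnS divnMDl// modnMDl.
(* Consecutive edges lie in one loop, or they are the last edge of a loop and the first edge of the
   next, which meet at [u]. *)
have [kM'|kM'] := ltnP (k %% M.+1).+1 M.+1.
  by rewrite (divn_small kM') addn0 (modn_small kM') st.
have -> : (k %% M.+1)%N = M by apply/eqP; rewrite eqn_leq -ltnS kM -ltnS.
rewrite divnn/= modnn addn1 tl.
by have [-> _ _] := ch (k %/ M.+1).+1.
Qed.

End GraphPaths.

Lemma block_seq (A : Type) N (w : nat -> A) q :
  block N w q = [seq w (q * N + i)%N | i <- iota 0 N] :> seq A.
Proof.
apply: (@eq_from_nth _ (w 0%N)) => [|i].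
  by rewrite size_tuple size_map size_iota.
rewrite size_tuple => iN; rewrite (nth_map 0%N) ?size_iota// nth_iota// add0n.
by rewrite -[i]/(val (Ordinal iN)) -tnth_nth tnth_mktuple.
Qed.

(** * Counting words by products of restricted adjacency matrices *)

Lemma sum_tuple_cons (R : nmodType) (T : finType) n (P : pred (seq T)) (F : seq T -> R) :
  \sum_(y : n.+1.-tuple T | P y) F y =
  \sum_(d : T) \sum_(y : n.-tuple T | P (d :: y)) F (d :: y).
Proof.
rewrite pair_big_dep/=.
rewrite (reindex (fun dy : T * n.-tuple T => [tuple of dy.1 :: dy.2]))//=.
exists (fun y : n.+1.-tuple T => (thead y, behead_tuple y)) => [[d y] _|y _] /=.
  by congr (_, _); apply: val_inj.
by rewrite -tuple_eta.
Qed.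

Section PathCount.
Variables (R : realType) (m : nat -> nat) (r : nat).
Variables (G : labelled_graph (D m r)) (G_res : right_resolving G).
Notation V := 'I_(nvert G).

(** A right-resolving labelling leaves at most one edge in the sum. *)
Lemma pathb_cons_nat (v : V) d x :
  pathb [set: V]%SET v (d :: x) =
  (\sum_(e : edge G | (source e == v) && (label e == d)) pathb [set: V]%SET (target e) x)%N :> nat.
Proof.
rewrite /= inE/=; case: existsP => [[e0 /and3P[sv ld px]]|nex].
  rewrite (big_pred1 e0) ?px// => e /=.
  apply/andP/eqP => [[se le]|->//]; apply/eqP; apply: contraT => ne.
  by have := G_res ne; rewrite (eqP se) (eqP sv) (eqP le) (eqP ld) eqxx => /(_ erefl).
rewrite big1// => e /andP[se le]; case px: (pathb _ _ _) => //.
by exfalso; apply: nex; exists e; rewrite se le px.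
Qed.

(** The row sum counts paths from [v], and a word labels at most one path from [v]. In the induction
    the first edges over [a] are grouped by label on one side and by target on the other. *)
Lemma path_count (s : seq (D m r.-1)) (v : V) :
  \sum_(y : (size s).-tuple (D m r) | map (@forget m r) y == s)
     (pathb [set: V]%SET v y)%:R =
  \sum_w (\prod_(d <- s) restricted_adj R G d) v w.
Proof.
elim: s v => [|a s IH] v.
  rewrite big_nil (big_pred1 [tuple]) => [|y]; last by rewrite tuple0 !eqxx.
  rewrite /= inE (bigD1 v)//= mxE eqxx big1 ?addr0// => w wv.
  by rewrite mxE eq_sym (negbTE wv).
rewrite big_cons.
transitivity (\sum_(e : edge G | (source e == v) && (forget (label e) == a))
    \sum_w (\prod_(d <- s) restricted_adj R G d) (target e) w).
  rewrite (@sum_tuple_cons _ _ _ (fun y => map (@forget m r) y == a :: s)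
    (fun y => (pathb [set: V]%SET v y)%:R)).
  under [RHS]eq_bigr => e _ do rewrite -IH.
  rewrite [RHS](exchange_big_dep (fun y : (size s).-tuple (D m r) =>
    map (@forget m r) y == s))//=.
  transitivity (\sum_(d : D m r)
      \sum_(y : (size s).-tuple (D m r) | (forget d == a) && (map (@forget m r) y == s))
      \sum_(e : edge G | (source e == v) && (label e == d))
        (pathb [set: V]%SET (target e) y)%:R : R).
    apply: eq_bigr => d _; apply: eq_big => y; first by rewrite eqseq_cons.
    by move=> _; rewrite pathb_cons_nat natr_sum.
  rewrite (exchange_big_dep (fun y : (size s).-tuple (D m r) =>
    map (@forget m r) y == s))/=; last first.
    by move=> d y _ /andP[].
  apply: eq_bigr => y ys.
  rewrite (exchange_big_dep (fun e : edge G =>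
    (source e == v) && (forget (label e) == a)))/=; last first.
    by move=> d e /andP[da _] /andP[-> /eqP ->].
  apply: eq_big => e; first by rewrite ys andbT.
  move=> /andP[sv la]; rewrite (big_pred1 (label e))// => d /=.
  rewrite sv ys/= andbT; apply/andP/eqP => [[_ /eqP]//|->]; by rewrite la eqxx.
rewrite (eq_bigr (fun w => \sum_u restricted_adj R G a v u *
  (\prod_(d <- s) restricted_adj R G d) u w)); last first.
  by move=> w _; rewrite mxE.
rewrite [RHS]exchange_big/=.
rewrite [LHS](partition_big (@target _ G) xpredT)//=; apply: eq_bigr => u _.
rewrite -mulr_sumr mxE.
rewrite (eq_bigr (fun=> \sum_w (\prod_(d <- s) restricted_adj R G d) u w)); last first.
  by move=> e /andP[_ /eqP ->].
rewrite sumr_const -[LHS]mulr_natl; congr (_%:R * _).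
apply: eq_card => e; apply/idP/idP => [/andP[/andP[se le] te]|/set_mem/and3P[se te le]].
  by apply/mem_set; rewrite /= se te le.
by rewrite unfold_in /= se te le.
Qed.

End PathCount.

(** * Equivalence of matrix norms *)

Section NormEquivalence.
Variables (R : realType) (n : nat) (nrm : 'M[R]_n -> R).
Hypothesis nrm_norm : matrix_norm nrm.

Let nrm0 : nrm 0 = 0.
Proof. by have [_ Z _] := nrm_norm; rewrite -(scale0r 0) Z normr0 mul0r. Qed.

Lemma nrm_ge0 A : 0 <= nrm A.
Proof.
have [_ Z T] := nrm_norm.
have := T A (- A); rewrite subrr nrm0 -scaleN1r Z normrN1 mul1r.
by move=> H; lra.
Qed.

(** [A] is expanded in elementary matrices; the summand 1 keeps [c] positive. *)
Lemma nrm_le_sum : exists2 c, 0 < c & forall A, nrm A <= c * \sum_i \sum_j `|A i j|.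
Proof.
have [_ Z T] := nrm_norm.
pose c := 1 + \sum_i \sum_j nrm (delta_mx i j).
have c1 i j : nrm (delta_mx i j) <= c.
  rewrite /c (bigD1 i)//= (bigD1 j)//=; set x := nrm _.
  set y := \sum_(_ < _ | _) _; set z := \sum_(_ < _ | _) _.
  have y0 : 0 <= y by apply: sumr_ge0 => ? _; exact: nrm_ge0.
  have z0 : 0 <= z by apply: sumr_ge0 => ? _; apply: sumr_ge0 => ? _; exact: nrm_ge0.
  lra.
exists c => [|A].
  rewrite /c ltr_wpDr//; apply: sumr_ge0 => ? _; apply: sumr_ge0 => ? _.
  exact: nrm_ge0.
have nrm_sum (I : finType) (F : I -> 'M[R]_n) : nrm (\sum_i F i) <= \sum_i nrm (F i).
  elim/big_rec2: _ => [|i y x _ xy]; first by rewrite nrm0.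
  by apply: le_trans (T _ _) _; rewrite lerD2l.
rewrite {1}[A]matrix_sum_delta; apply: le_trans (nrm_sum _ _) _.
rewrite mulr_sumr; apply: ler_sum => i _; apply: le_trans (nrm_sum _ _) _.
rewrite mulr_sumr; apply: ler_sum => j _.
by rewrite Z mulrC ler_wpM2r.
Qed.

(** The norm is continuous and has a positive minimum on the compact unit sphere of the sup norm.
    Matrices are flattened to row vectors to fit the extreme value theorem. *)
Lemma nrm_ge_sum : exists2 c, 0 < c & forall A : 'M[R]_n, c * \sum_i \sum_j `|A i j| <= nrm A.
Proof.
have [E Z T] := nrm_norm; have [C C0 CP] := nrm_le_sum.
(* For [n = 0] the sphere is empty and has no minimum. *)
have [n0|n_gt0] := posnP n.
  exists 1 => // A; rewrite mul1r big1 ?nrm_ge0// => i _; by have := ltn_ord i; rewrite {2}n0.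
pose f (v : 'rV[R]_(n * n)) := nrm (vec_mx v).
have entry (v : 'rV[R]_(n * n)) i j : `|vec_mx v i j| <= `|v|.
  rewrite mxE [leRHS]/Num.Def.normr /= mx_normrE; apply/bigmax_geP; right => /=.
  by exists (ord0, mxvec_index i j).
have f_le v : f v <= C * (n * n)%:R * `|v|.
  apply: le_trans (CP _) _; rewrite -mulrA ler_wpM2l ?(ltW C0)//.
  apply: (@le_trans _ _ (\sum_(i < n) \sum_(j < n) `|v|)).
    by apply: ler_sum => i _; apply: ler_sum => j _; exact: entry.
  by rewrite !sumr_const !card_ord -mulrnA -[leLHS]mulr_natl.
have f_lip v w : `|f v - f w| <= C * (n * n)%:R * `|v - w|.
  have H x y : f x - f y <= C * (n * n)%:R * `|x - y|.
    apply: le_trans (f_le _); rewrite lerBlDr.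
    by apply: le_trans (T _ _); rewrite -linearD/= subrK.
  by rewrite ler_norml H andbT lerNl opprB distrC H.
have nn0 : (0 < n * n)%N by rewrite muln_gt0 n_gt0.
pose S := [set v : 'rV[R]_(n * n) | `|v| = 1].
have S0 : S !=set0.
  exists (const_mx 1); rewrite /S/= /Num.Def.normr/= mx_normrE.
  apply/eqP; rewrite eq_le; apply/andP; split.
    by apply: bigmax_le => // i _; rewrite mxE normr1.
  apply/bigmax_geP; right; exists (ord0, Ordinal nn0) => //=.
  by rewrite mxE normr1.
have Sc : compact S.
  apply: bounded_closed_compact.
    exists 1; split => // x x1 v; rewrite /S/= => ->; exact: ltW.
  have -> : S = (fun v => `|v|) @^-1` [set x | x = 1] by [].
  apply: preimage_closed; last exact: closed_eq.
  by move=> v _; exact: norm_continuous.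
have Cn0 : 0 < C * (n * n)%:R by rewrite mulr_gt0// ltr0n.
have fc : continuous f.
  move=> v; apply/(@cvgrPdist_le _ _ _ (nbhs v) (nbhs_filter v)) => e e0.
  apply: (@nbhs_normP R 'rV[R]_(n * n) v _).2.
  exists (e / (C * (n * n)%:R)); first exact: divr_gt0.
  move=> w /ltW; rewrite ler_pdivlMr// mulrC; exact: le_trans (f_lip v w).
have [v /set_mem Sv vmin] := EVT_min_rV S0 Sc (continuous_subspaceT fc).
have fv0 : 0 < f v.
  rewrite lt_def nrm_ge0 andbT; apply/eqP => /E v0.
  by move: Sv; rewrite /S/= -[v]vec_mxK v0 linear0 normr0 => /eqP; rewrite eq_sym oner_eq0.
exists (f v / (n * n)%:R) => [|A]; first by rewrite divr_gt0// ltr0n.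
set u := mxvec A.
have sum_le : \sum_i \sum_j `|A i j| <= (n * n)%:R * `|u|.
  apply: (@le_trans _ _ (\sum_(i < n) \sum_(j < n) `|u|)).
    by apply: ler_sum => i _; apply: ler_sum => j _; rewrite -[A]mxvecK entry.
  by rewrite !sumr_const !card_ord -mulrnA -[leLHS]mulr_natl.
have fu : f v * `|u| <= nrm A.
  have [->|u0] := eqVneq `|u| 0; first by rewrite mulr0 nrm_ge0.
  have u_gt0 : 0 < `|u| by rewrite lt_def u0 normr_ge0.
  rewrite -ler_pdivlMr// (_ : nrm A / `|u| = f (`|u|^-1 *: u)); last first.
    by rewrite /f linearZ/= mxvecK Z ger0_norm ?invr_ge0// mulrC.
  apply: vmin; apply/mem_set; rewrite /S/= normrZ ger0_norm ?invr_ge0//.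
  by rewrite mulVf.
apply: le_trans fu; rewrite -mulrA ler_wpM2l ?(ltW fv0)// ler_pdivrMl ?ltr0n//.
Qed.

End NormEquivalence.

(** * Decomposition of paths into loops *)

Section PathSums.
Variables (R : realType) (m : nat -> nat) (r : nat) (d0 : D m r) (b : nat -> R).
Hypothesis b01 : forall i, 0 < b i <= 1.
Variable G : labelled_graph (D m r).
Notation V := 'I_(nvert G).

Lemma nsum_point_le1 (W : finType) (tau : nat -> W -> W) i (y : W) :
  nsum b tau i (fun x => (x == y)%:R) <= 1.
Proof.
elim: i y => [|i IH] y.
  rewrite /= big_mkcond (bigD1 y)//= eqxx big1 ?addr0; first by case: ifP.
  by move=> x /negbTE ->; case: ifP.
rewrite nsumS; apply: le_trans (IH (tau i y)); apply: nsum_le => // [x|x ix].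
  exact: powR_ge0.
have [->|xy] := eqVneq x (tau i y).
  apply: (@le_trans _ _ (1 `^ b i)); last by rewrite powR1.
  apply: powR_homo; first by case/andP: (b01 i) => /ltW.
    exact: sumr_ge0.
  rewrite big_mkcond (bigD1 y)//= big1 ?addr0; first by case: ifP; rewrite ?(eqxx y).
  by move=> z /negbTE ->; case: ifP.
rewrite big1 ?powR0 ?gt_eqF//; first by case/andP: (b01 i).
move=> z /andP[_ /eqP zx]; case: eqP => // zy.
by move: xy; rewrite -zy zx eqxx.
Qed.

Lemma wsum_card N (P : pred (seq (D m r))) :
  wsum d0 b N P <= #|{: N.-tuple (D m r)}|%:R.
Proof.
apply: (@le_trans _ _ (\sum_(y : N.-tuple (D m r))
    nsum b (tauw d0 (N := N)) r (fun x => (x == y)%:R))).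
  apply: le_trans (nsum_sum_le b01 _ _ _ _) => //.
  apply: nsum_le => // x _; rewrite (bigD1 x)//= eqxx.
  by rewrite ler_wpDr ?sumr_ge0// lern1 leq_b1.
rewrite -[leRHS]mulr1 mulr_natl -sumr_const; apply: ler_sum => y _.
exact: nsum_point_le1.
Qed.

Lemma wsum_le0 N (P : pred (seq (D m r))) :
  (forall x, size x = N -> P x -> False) -> wsum d0 b N P <= 0.
Proof.
move=> P0; apply: le_trans (wsum_union d0 b01 (Q := fun _ : 'I_0 => P) _) _.
  by move=> x sx /P0; case.
by rewrite big_ord0.
Qed.

(** Induction on the number of vertices that a path may use: a path from [v] is a loop at [v],
    possibly followed by one letter and a path avoiding [v]. The factor [N.+1] counts the loop
    lengths, [#|D m r|] bounds the letter, [nvert G] counts the starting vertices of the rest, and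
    the summand 1 covers a path that is all loop. *)
Lemma wsum_pathb (N : nat) (rho Phi : R) : 1 <= rho -> 1 <= Phi ->
  (forall (u : V) l, (l <= N)%N -> wsum d0 b l (fun x => runb u x u) <= Phi * rho ^+ l) ->
  forall k (A : {set V}) v N', (#|A| <= k)%N -> (N' <= N)%N ->
  wsum d0 b N' (pathb A v) <=
    (N.+1%:R * Phi * (1 + #|D m r|%:R * (nvert G)%:R)) ^+ k * rho ^+ N'.
Proof.
move=> rho1 Phi1 loops; set Q : R := #|D m r|%:R * (nvert G)%:R.
set Theta := _ * _ * _.
have rho0 : 0 <= rho by exact: le_trans rho1.
have Phi0 : 0 <= Phi by exact: le_trans Phi1.
have Q0 : 0 <= Q by rewrite mulr_ge0.
have T1 : 1 <= Theta.
  rewrite /Theta -[leLHS]mulr1 -[leLHS]mulr1 !ler_pM ?mulr_ge0//.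
    by rewrite ler1n.
  by rewrite lerDl.
elim=> [|k IH] A v N' Ak N'N.
  rewrite expr0 mul1r; apply: (@le_trans _ _ 0); last exact: exprn_ge0.
  apply: wsum_le0 => x _ /pathb_in vA; move: Ak; rewrite leqn0 cards_eq0 => /eqP A0.
  by rewrite A0 inE in vA.
have T0 : 0 <= Theta by exact: le_trans T1.
have [vA|vA] := boolP (v \in A); last first.
  apply: (@le_trans _ _ 0); last by rewrite mulr_ge0 ?exprn_ge0.
  by apply: wsum_le0 => x _ /pathb_in; exact/negP.
have Avk : (#|A :\ v| <= k)%N by move: Ak; rewrite (cardsD1 v) vA.
pose P (l : 'I_N.+1) x := [&& (l <= size x)%N, runb v (take l x) v &
  (l == size x :> nat) || (l < size x)%N && [exists v', pathb (A :\ v) v' (drop l.+1 x)]].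
have Tk1 : 1 <= Theta ^+ k by rewrite exprn_ege1.
have Tk0 : 0 <= Theta ^+ k by exact: exprn_ge0.
have bound (l : 'I_N.+1) : wsum d0 b N' (P l) <= Phi * (1 + Q) * Theta ^+ k * rho ^+ N'.
  have [lN|lN|lN] := ltngtP l N'.
  - have NE : N' = (l + (1 + (N' - l.+1)))%N by lia.
    rewrite {1}NE.
    pose F y := [exists v', pathb (A :\ v) v' (drop 1 y)].
    apply: (@le_trans _ _ (wsum d0 b (l + (1 + (N' - l.+1))) 
        (fun x => runb v (take l x) v && F (drop l x)))).
      apply: wsum_le => // x sx /and3P[_ -> /orP[/eqP lx|/andP[_ ex]]].
        by move: lN; rewrite {1}lx sx -NE ltnn.
      by rewrite /F drop_drop add1n.
    rewrite (wsum_cat d0 b l _ (fun y => runb v y v) F).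
    have F_le : wsum d0 b (1 + (N' - l.+1)) F <= Q * (Theta ^+ k * rho ^+ (N' - l.+1)).
      apply: (@le_trans _ _ (wsum d0 b (1 + (N' - l.+1))
        (fun y => xpredT (take 1 y) && [exists v', pathb (A :\ v) v' (drop 1 y)]))).
        exact: wsum_le.
      rewrite (wsum_cat d0 b 1 _ xpredT (fun y => [exists v', pathb (A :\ v) v' y])).
      rewrite /Q -mulrA; apply: ler_pM; rewrite ?wsum_ge0//.
        apply: le_trans (wsum_card 1 _) _.
        by rewrite card_tuple expn1.
      apply: (@le_trans _ _ (\sum_v' wsum d0 b (N' - l.+1) (pathb (A :\ v) v'))).
        by apply: wsum_union => // x _ /existsP.
      apply: (@le_trans _ _ (\sum_(v' : V) Theta ^+ k * rho ^+ (N' - l.+1))).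
        by apply: ler_sum => v' _; apply: IH => //; apply: leq_trans N'N; exact: leq_subr.
      by rewrite sumr_const card_ord mulr_natl.
    apply: (@le_trans _ _ (Phi * rho ^+ l * (Q * (Theta ^+ k * rho ^+ (N' - l.+1))))).
      by apply: ler_pM; rewrite ?wsum_ge0// loops// ltnW// (leq_trans lN).
    rewrite (_ : _ * _ = Phi * Q * Theta ^+ k * rho ^+ (l + (N' - l.+1))); last first.
      by rewrite exprD; ring.
    apply: ler_pM; rewrite ?mulr_ge0 ?exprn_ge0//.
      by rewrite ler_wpM2r// ler_wpM2l// lerDr.
    (* The connecting letter is missing from the exponent, which is harmless since [1 <= rho]. *)
    by rewrite ler_weXn2l//; lia.
  - apply: (@le_trans _ _ 0); last by rewrite !mulr_ge0 ?exprn_ge0 ?addr_ge0.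
    by apply: wsum_le0 => x sx /and3P[]; rewrite sx leqNgt lN.
  - apply: (@le_trans _ _ (Phi * rho ^+ N')).
      apply: le_trans (loops v N' N'N); apply: wsum_le => // x sx /and3P[_ + _].
      by rewrite lN -sx take_size.
    rewrite ler_wpM2r ?exprn_ge0// -[leLHS]mulr1 -[leLHS]mulr1 !ler_pM ?mulr_ge0//.
    by rewrite lerDl.
apply: (@le_trans _ _ (\sum_(l < N.+1) wsum d0 b N' (P l))).
  apply: wsum_union => // x sx px; have [px'|[l [lx rl lrest]]] := pathb_split v px.
    by have := pathb_in px'; rewrite !inE eqxx.
  have lN : (l < N.+1)%N by rewrite ltnS (leq_trans lx)// sx.
  exists (Ordinal lN); rewrite /P /= lx rl /=.
  case: lrest => [->|[-> [v' pv']]]; first by rewrite eqxx.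
  by apply/orP; right; apply/existsP; exists v'.
apply: (le_trans (ler_sum _ (fun l _ => bound l))).
rewrite sumr_const card_ord -[leLHS]mulr_natl exprS /Theta -/Q.
by rewrite le_eqVlt; apply/orP; left; apply/eqP; ring.
Qed.

End PathSums.

(** * The limit formula *)

Lemma cvg_log_rate (R : realType) (u : nat -> R) (h A B : R) : 0 <= A -> 0 <= B ->
  (forall N, (0 < N)%N -> `|u N - h| <= (A + B * ln N.+1%:R) / N%:R) ->
  u @ \oo --> h.
Proof.
move=> A0 B0 uh; apply/cvgrPdist_le => e e0.
(* [ln N.+1%:R] is at most [d * N.+1%:R] plus a constant, and this [d] keeps [B * d] below
   [e / 2]. *)
pose d := e / (2 * (B + 1)).
have B1 : 0 < 2 * (B + 1) by rewrite mulr_gt0// ltr_wpDl.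
have d0 : 0 < d by rewrite divr_gt0.
have Bd : B * d <= e / 2.
  rewrite /d mulrA ler_pdivrMr// mulrC; nra.
pose X := A + B * d + B * `|ln d|.
have X0 : 0 <= X.
  apply: addr_ge0; last exact: mulr_ge0.
  by apply: addr_ge0 => //; apply: mulr_ge0 => //; exact: ltW.
exists (Num.truncn (X / (e / 2))).+1 => // N /= NX.
have N0 : (0 < N)%N by apply: leq_ltn_trans NX.
have NR : 0 < N%:R :> R by rewrite ltr0n.
rewrite distrC; apply: (le_trans (uh N N0)); rewrite ler_pdivrMr//.
have XN : X <= e / 2 * N%:R.
  rewrite -ler_pdivrMl ?divr_gt0// mulrC.
  have /andP[_ H] := truncn_itv (divr_ge0 X0 (ltW (divr_gt0 e0 (ltr0n R 2)))).
  by apply: le_trans (ltW H) _; rewrite ler_nat.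
have N1 : 0 < N.+1%:R :> R by rewrite ltr0n.
have lnN : ln N.+1%:R <= d * N.+1%:R + `|ln d|.
  have dN : 0 < d * N.+1%:R by exact: mulr_gt0.
  have := expR_ge1Dx (ln (d * N.+1%:R)); rewrite [expR _]lnK ?posrE//.
  rewrite lnM ?posrE//.
  have := ler_norm (- ln d); rewrite normrN; lra.
have := ler_wpM2l B0 lnN; rewrite -natr1.
have := ler_wpM2r (ltW NR) Bd; rewrite /X in XN; lra.
Qed.

Section PathNorm.
Variables (R : realType) (m : nat -> nat) (r : nat).
Variables (G : labelled_graph (D m r)) (G_res : right_resolving G).
Notation V := 'I_(nvert G).

Lemma prod_adj_ge0 (s : seq (D m r.-1)) (v w : V) :
  0 <= (\prod_(d <- s) restricted_adj R G d) v w.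
Proof.
elim: s v w => [|a s IH] v w; first by rewrite big_nil mxE.
by rewrite big_cons mxE; apply: sumr_ge0 => u _; rewrite mulr_ge0// mxE.
Qed.

Definition path_word : pred (seq (D m r)) :=
  fun x => [exists v : V, pathb [set: V]%SET v x].

Lemma path_count_tuple n (s : n.-tuple (D m r.-1)) (v : V) :
  \sum_(y : n.-tuple (D m r) | map (@forget m r) y == s) (pathb [set: V]%SET v y)%:R =
  \sum_w (\prod_(d <- s) restricted_adj R G d) v w.
Proof. by case: s => s /= sz; move: (sz) => /eqP <-; exact: path_count. Qed.

Definition word_count n (s : n.-tuple (D m r.-1)) : R :=
  \sum_(y : n.-tuple (D m r) | map (@forget m r) y == s) (path_word y)%:R.

(** The entries count a word once for every vertex from which it can be read, that is, between 1 and
    [nvert G] times if it labels a path. *)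
Lemma entry_sum_bounds n (s : n.-tuple (D m r.-1)) :
  word_count s <= \sum_v \sum_w `|(\prod_(d <- s) restricted_adj R G d) v w|
    <= (nvert G)%:R * word_count s.
Proof.
have -> : \sum_v \sum_w `|(\prod_(d <- s) restricted_adj R G d) v w| =
    \sum_(y : n.-tuple (D m r) | map (@forget m r) y == s)
       \sum_(v : V) (pathb [set: V]%SET v y)%:R.
  rewrite [RHS]exchange_big/=; apply: eq_bigr => v _; rewrite path_count_tuple.
  by apply: eq_bigr => w _; rewrite ger0_norm// prod_adj_ge0.
rewrite /word_count mulr_sumr; apply/andP; split; apply: ler_sum => y _.
  rewrite /path_word; case: existsP => [[v pv]|_]; last exact: sumr_ge0.
  by rewrite (bigD1 v)//= pv lerDl sumr_ge0.
rewrite /path_word; case: existsP => [_|np].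
  rewrite mulr1 -[X in _ <= X%:R]card_ord -sum1_card natr_sum.
  by apply: ler_sum => v _; case: (pathb _ _ _).
rewrite mulr0 big1// => v _; case pv: (pathb _ _ _) => //.
by exfalso; apply: np; exists v.
Qed.

End PathNorm.

(** By equivalence of norms, the norm of the product is comparable to the number of path words above
    [s], and [nsumZ] carries the constants out of the nested sum independently of [N]. *)
Lemma nested_sum_bounds (R : realType) (m : nat -> nat) (r : nat) (r_ge2 : (2 <= r)%N)
    (d0 : D m r) (m1_ge2 : (2 <= m 1)%N)
    (m_le : forall i, (1 <= i < r)%N -> (m i <= m i.+1)%N)
    (G : labelled_graph (D m r)) (G_res : right_resolving G)
    (nrm : 'M[R]_(nvert G) -> R) (nrm_norm : matrix_norm nrm) :
  let a i := log_base (m i.+1)%:R (m i)%:R in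
  exists c1 c2 : R, [/\ 0 < c1, 0 < c2 & forall N,
  c1 * wsum d0 (expo R m r) N (path_word G) <=
  nested_sum a (fun s : word m r.-1 N =>
       nrm (\prod_(d <- s) restricted_adj R G d) `^ a r.-1) <=
  c2 * wsum d0 (expo R m r) N (path_word G)].
Proof.
move=> a; case: r r_ge2 d0 m_le G G_res nrm nrm_norm => [//|[//|r]] _ d0 m_le G G_res nrm nrm_norm.
have [k1 k1_gt0 k1P] := nrm_ge_sum nrm_norm.
have [k2 k2_gt0 k2P] := nrm_le_sum nrm_norm.
set b := expo R m r.+2.
have b01 i : 0 < b i <= 1 by exact: expo01.
have ba : b r.+1 = a r.+1 by rewrite /b /expo leqnn.
(* The successor keeps the constant positive even for a graph without vertices. *)
pose n1 : R := (nvert G).+1%:R.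
have n1_gt0 : 0 < n1 by rewrite ltr0n.
exists ((k1 `^ b r.+1) `^ theta b r.+1), (((k2 * n1) `^ b r.+1) `^ theta b r.+1).
split=> [||N]; [by rewrite !powR_gt0|by rewrite !powR_gt0// mulr_gt0|].
rewrite (nested_nsum d0 (b := b) (leqnSn r.+1)); first last.
- by move=> j jr; rewrite /b /expo jr.
- by [].
- by move=> s; exact: powR_ge0.
pose c (x : N.-tuple (D m r.+2)) : R := \sum_(y : N.-tuple (D m r.+2) |
   (tauw d0 r.+2 y == y) && (tauw d0 r.+1 y == x)) (path_word G y)%:R.
have wE : wsum d0 b N (path_word G) =
    nsum b (tauw d0 (N := N)) r.+1 (fun x => c x `^ b r.+1) by rewrite /wsum nsumS.
rewrite wE -(nsumZ b (tauw d0 (N := N)) r.+1 (powR_ge0 k1 (b r.+1))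
  (F := fun x => c x `^ b r.+1)); last first.
  by move=> x; exact: powR_ge0.
rewrite -(nsumZ b (tauw d0 (N := N)) r.+1 (powR_ge0 (k2 * n1) (b r.+1))
  (F := fun x => c x `^ b r.+1)); last first.
  by move=> x; exact: powR_ge0.
have cP x : tauw d0 r.+1 x = x ->
    k1 * c x <= nrm (\prod_(d <- projw (leqnSn r.+1) x) restricted_adj R G d)
    <= k2 * n1 * c x.
  move=> xr.
  have cE : c x = word_count R G (projw (leqnSn r.+1) x).
    have projT (y : N.-tuple (D m r.+2)) : projw (leqnn r.+2) y = y.
      apply/eq_from_tnth => k; rewrite tnth_map; apply/ffunP => -[j jr].
      rewrite !ffunE /widen_ord/=; set q := widen_ord_proof _ _.
      by rewrite (bool_irrelevance q jr).
    transitivity (\sum_(y : N.-tuple (D m r.+2) | (tauw d0 r.+2 y == y) && (tauw d0 r.+1 y == x))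
        (path_word G (projw (leqnn r.+2) y))%:R : R).
      by apply: eq_bigr => y _; rewrite projT.
    rewrite -(big_fibre (leqnn r.+2) (fun y : word m r.+2 N => (path_word G y)%:R) xr).
    rewrite /word_count (bool_irrelevance (leqnSn r.+1) (ltnW (leqnn r.+2))).
    by apply: eq_bigl => y; rewrite -val_eqE.
  have /andP[lo hi] := entry_sum_bounds R G_res (projw (leqnSn r.+1) x).
  rewrite -cE in lo hi.
  apply/andP; split.
    by apply: le_trans (k1P _); rewrite ler_wpM2l// ltW.
  apply: le_trans (k2P _) _; rewrite -mulrA ler_wpM2l ?(ltW k2_gt0)//.
  apply: (le_trans hi); rewrite ler_wpM2r//; first exact: sumr_ge0.
  by rewrite ler_nat.
have c0 x : 0 <= c x by exact: sumr_ge0.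
have b0 : 0 <= b r.+1 by case/andP: (b01 r.+1) => /ltW.
apply/andP; split; apply: nsum_le => // x.
- by rewrite mulr_ge0 ?powR_ge0.
- move=> /cP/andP[lo _]; rewrite -powRM ?(ltW k1_gt0)//= -ba.
  by apply: powR_homo => //; rewrite mulr_ge0// ltW.
- exact: powR_ge0.
- move=> /cP/andP[_ hi]; rewrite -powRM ?mulr_ge0 ?(ltW k2_gt0)//= -ba.
  by apply: powR_homo => //; exact: nrm_ge0.
Qed.

(** [hdim_lower] bounds the loops at a vertex, whose concatenations all stay in the sofic system,
    and [wsum_pathb] passes from loops to paths. All losses are polynomial in [N], hence logarithmic
    here. *)
Lemma wsum_path_le (R : realType) (m : nat -> nat) (r : nat) (d0 : D m r)
    (m1_ge2 : (2 <= m 1)%N) (r_gt0 : (0 < r)%N)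
    (m_le : forall i, (1 <= i < r)%N -> (m i <= m i.+1)%N)
    (G : labelled_graph (D m r)) (h : R) : 0 <= h ->
  (hausdorff_dim (@expansion m R r @` sofic G) <= h%:E)%E ->
  exists A B : R, [/\ 0 <= A, 0 <= B & forall N, (0 < N)%N ->
    0 < wsum d0 (expo R m r) N (path_word G) ->
    ln (wsum d0 (expo R m r) N (path_word G)) <=
    A + B * ln N.+1%:R + N%:R * ln (m 1)%:R * h].
Proof.
move=> h0 dimh; set b := expo R m r.
have b01 i : 0 < b i <= 1 by exact: expo01.
set q := #|D m r|; set n := nvert G.
have l1 : 0 < ln (m 1)%:R :> R by exact: (ln_base_gt0 R m1_ge2 m_le r_gt0).
pose rho := expR (ln (m 1)%:R * h).
have rho1 : 1 <= rho by rewrite /rho -[leLHS]expR0 ler_expR mulr_ge0// ltW.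
have rhoX N : rho ^+ N = expR (N%:R * ln (m 1)%:R * h).
  by rewrite /rho -expRM_natl mulrA.
(* The number of dyadic classes is linear in the length, which makes [Phi] polynomial. *)
have trunc_log_le l : (trunc_log 2 #|{: l.-tuple (D m r)}| <= l * q)%N.
  rewrite card_tuple -/q -[leqRHS](@trunc_expnK 2 _ isT).
  apply: leq_trunc_log; rewrite mulnC expnM; case: l => // l.
  by rewrite leq_exp2r// ltnW// ltn_expl.
pose Phi N : R := (2 * (N * q).+1)%:R ^+ r.
have Phi1 N : 1 <= Phi N by rewrite exprn_ege1// ler1n muln_gt0.
have loops N (u : 'I_(nvert G)) l : (l <= N)%N ->
    wsum d0 b l (fun x => runb u x u) <= Phi N * rho ^+ l.
  (* The empty loop is separate, since [hdim_lower] concerns blocks of positive length. *)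
  case: l => [|M] lN.
    apply: le_trans (wsum_card d0 b01 0 _) _.
    by rewrite expr0 mulr1 card_tuple expn0.
  have := @hdim_lower R m r d0 r_gt0 m1_ge2 m_le M (fun x => runb u x u) (sofic G) h.
  move=> /(_ _ h0 dimh) H; apply: le_trans (H _) _.
    by move=> w wu; apply: (@sofic_loops _ _ M u) => k; rewrite -block_seq.
  rewrite rhoX ler_wpM2r ?expR_ge0// lerXn2r ?nnegrE// ler_nat leq_mul2l/= ltnS.
  by apply: leq_trans (trunc_log_le _) _; rewrite leq_mul2r lN orbT.
have paths N := wsum_pathb (d0 := d0) b01 rho1 (Phi1 N) (@loops N).
pose Theta N : R := N.+1%:R * Phi N * (1 + q%:R * n%:R).
pose C : R := (2 * q.+1)%:R ^+ r * (1 + q%:R * n%:R).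
have qn0 : 0 <= q%:R * n%:R :> R by rewrite mulr_ge0.
have C0 : 1 <= C.
  rewrite /C -[leLHS]mulr1 ler_pM// ?lerDl//.
  by rewrite exprn_ege1// ler1n muln_gt0.
have Theta_le N : Theta N <= C * N.+1%:R ^+ r.+1.
  rewrite /Theta /C /Phi exprS.
  rewrite (_ : _ * _ * (N.+1%:R * _) =
    N.+1%:R * ((2 * q.+1)%:R ^+ r * N.+1%:R ^+ r) * (1 + q%:R * n%:R)); last by ring.
  rewrite ler_wpM2r ?addr_ge0// ler_wpM2l// -exprMn -natrM lerXn2r ?nnegrE// ler_nat.
  by nia.
have Theta1 N : 1 <= Theta N.
  rewrite /Theta -[leLHS]mulr1 -[leLHS]mulr1 !ler_pM ?mulr_ge0//.
  - by rewrite ler1n.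
  - by rewrite lerDl.
exists (ln n.+1%:R + n%:R * ln C), (n%:R * r.+1%:R); split.
- by rewrite addr_ge0 ?mulr_ge0// ln_ge0// ler1n.
- by rewrite mulr_ge0.
move=> N N0 w0.
have wle : wsum d0 b N (path_word G) <= n.+1%:R * (C * N.+1%:R ^+ r.+1) ^+ n * rho ^+ N.
  apply: (@le_trans _ _ (\sum_(v : 'I_n) wsum d0 b N (pathb [set: 'I_n]%SET v))).
    by apply: wsum_union => // x _ /existsP.
  apply: (@le_trans _ _ (\sum_(v : 'I_n) Theta N ^+ n * rho ^+ N)).
    apply: ler_sum => v _; apply: paths => //.
    by rewrite cardsT card_ord.
  rewrite sumr_const card_ord -[leLHS]mulr_natl mulrA.
  rewrite ler_wpM2r ?exprn_ge0 ?expR_ge0//; apply: ler_pM => //.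
  - by apply: exprn_ge0; exact: le_trans (Theta1 N).
  - by rewrite ler_nat.
  - have TN0 : 0 <= Theta N by exact: le_trans (Theta1 N).
    by rewrite lerXn2r ?nnegrE// (le_trans TN0).
have N1 : 0 < N.+1%:R :> R by rewrite ltr0n.
have C00 : 0 < C by exact: lt_le_trans C0.
have CN : 0 < C * N.+1%:R ^+ r.+1 by rewrite mulr_gt0// exprn_gt0.
clearbody C.
have := wle; rewrite -ler_ln ?posrE ?mulr_gt0 ?exprn_gt0 ?expR_gt0//.
rewrite !lnM ?posrE ?mulr_gt0 ?exprn_gt0 ?expR_gt0// rhoX expRK.
rewrite lnXn// lnM ?posrE ?exprn_gt0// lnXn//.
rewrite -[(_ + _) *+ n]mulr_natl -[_ *+ r.+1]mulr_natl => H.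
by apply: (le_trans H); lra.
Qed.

Theorem corollary2p6 (R : realType) (r : nat) (m : nat -> nat)
    (r_ge2 : (2 <= r)%N) (m1_ge2 : (2 <= m 1%N)%N)
    (m_le : forall i, (1 <= i < r)%N -> (m i <= m i.+1)%N)
    (G : labelled_graph (D m r)) (G_resolving : right_resolving G)
    (S_nonempty : sofic G !=set0)
    (nrm : 'M[R]_(nvert G) -> R) (nrm_norm : matrix_norm nrm) :
  let X := @expansion m R r @` sofic G in
  let a i := log_base (m i.+1)%:R (m i)%:R in
  let u N := N%:R^-1 * log_base (m 1%N)%:R
    (nested_sum a (fun s : word m r.-1 N =>
       nrm (\prod_(d <- s) restricted_adj R G d) `^ a r.-1)) in
  cvgn u /\ hausdorff_dim X = (limn u)%:E.
Proof.
move=> X a u.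
have [w0 Sw0] := S_nonempty; pose d0 := w0 0%N.
have r_gt0 : (0 < r)%N by exact: ltnW.
pose b := expo R m r.
have l1 : 0 < ln (m 1)%:R :> R by exact: (ln_base_gt0 R m1_ge2 m_le r_gt0).
have words w : sofic G w -> forall N q, path_word G (block N w q).
  by move=> Sw N q; apply/existsP; rewrite block_seq; exact: sofic_block.
have upper N (N0 : (0 < N)%N) : (hausdorff_dim X <=
    (ln (wsum d0 b N (path_word G)) / (N%:R * ln (m 1)%:R))%:E)%E.
  by apply: hdim_upper => // w Sw q; exact: words.
(* The upper bound for [N = 1] already makes the dimension finite. *)
have dim_fin : hausdorff_dim X \is a fin_num.
  rewrite ge0_fin_numE ?hausdorff_dim_ge0//.
  by apply: le_lt_trans (upper 1%N _) _; rewrite // ltry.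
pose h := fine (hausdorff_dim X).
have dimE : hausdorff_dim X = h%:E by rewrite fineK.
have h0 : 0 <= h by apply: fine_ge0; exact: hausdorff_dim_ge0.
suff uh : u @ \oo --> h.
  split; first by apply/cvg_ex; exists h.
  by rewrite dimE (cvg_lim _ uh).
have [A [B [A0 B0 AB]]] := wsum_path_le d0 m1_ge2 r_gt0 m_le h0
  (eq_ind_r (fun x => (x <= h%:E)%E) (lexx h%:E) dimE).
have [c1 [c2 [c1_gt0 c2_gt0 cP]]] :=
  nested_sum_bounds r_ge2 d0 m1_ge2 m_le G_resolving nrm_norm.
have w1 N : 1 <= wsum d0 b N (path_word G) by apply: wsum_ge1 => //; exact: (words _ Sw0 N 0%N).
apply: (@cvg_log_rate _ u h ((`|ln c1| + `|ln c2| + A) / ln (m 1)%:R) (B / ln (m 1)%:R)).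
- by rewrite divr_ge0 ?(ltW l1)// !addr_ge0.
- by rewrite divr_ge0// ltW.
move=> N N0; have /andP[lo hi] := cP N.
have NR : 0 < N%:R :> R by rewrite ltr0n.
have wN : 0 < wsum d0 b N (path_word G) by exact: lt_le_trans (w1 N).
rewrite /u; set Z := nested_sum _ _ in lo hi *.
have cw1 : 0 < c1 * wsum d0 b N (path_word G) by exact: mulr_gt0.
have cw2 : 0 < c2 * wsum d0 b N (path_word G) by exact: mulr_gt0.
have Z0 : 0 < Z by exact: lt_le_trans lo.
have := lo; rewrite -ler_ln ?posrE// lnM ?posrE// => {}lo.
have := hi; rewrite -ler_ln ?posrE// lnM ?posrE// => {}hi.
(* [low] and [up] enclose the logarithm of [wsum] around [N%:R * ln (m 1)%:R * h] with a logarithmic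
   error; [lo] and [hi] transfer this to [Z]. *)
have := AB N N0 wN; rewrite -/b => up.
have := upper N N0; rewrite dimE lee_fin ler_pdivlMr ?mulr_gt0// => low.
have n1 := ler_norm (ln c2); have n2 := ler_norm (- ln c1); rewrite normrN in n2.
have a1 := normr_ge0 (ln c1); have a2 := normr_ge0 (ln c2).
have ln0 : 0 <= B * ln N.+1%:R by rewrite mulr_ge0// ln_ge0// ler1n.
have -> : N%:R^-1 * log_base (m 1)%:R Z - h =
    (ln Z - N%:R * ln (m 1)%:R * h) / (N%:R * ln (m 1)%:R).
  by rewrite /log_base; field; rewrite !gt_eqF.
have -> : ((`|ln c1| + `|ln c2| + A) / ln (m 1)%:R + B / ln (m 1)%:R * ln N.+1%:R) / N%:R =
    (`|ln c1| + `|ln c2| + A + B * ln N.+1%:R) / (N%:R * ln (m 1)%:R).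
  by field; rewrite !gt_eqF.
rewrite normrM [X in _ * X]ger0_norm ?invr_ge0 ?mulr_ge0 ?(ltW l1)//.
rewrite ler_wpM2r ?invr_ge0 ?mulr_ge0 ?(ltW l1)//.
rewrite ler_norml; apply/andP; split; lra.
Qed.
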